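(* Let $k$ be an algebraically closed field containing $\mathbb{F}_3$ and let $\Phi$ be the relative Frobenius operator on meromorphic differential forms on $\mathbb{P}^1_k$. Every space $L_{15,2}$ $\Omega$ of meromorphic differential forms on $\mathbb{P}^1_k$ is equivalent to one of the five spaces $\Omega_1$, $\Phi(\Omega_1)$, $\Phi^2(\Omega_1)$, $\Omega_2$, $\Phi(\Omega_2)$ (defined in the context), and these five spaces lie in pairwise distinct equivalence classes.
   Context: Here $p=3$. Meromorphic differential forms on $\mathbb{P}^1_k$ are $f(X)\,dX$, $f\in k(X)$; order at $\infty$ is $\mathrm{ord}_0(f(1/X))-2$. A form is logarithmic if it equals $dF/F$ for some nonzero $F\in k(X)$. For positive integers $m,n$, a space $L_{m+1,n}$ is an $n$-dimensional $\mathbb{F}_p$-vector space of meromorphic differential forms on $\mathbb{P}^1_k$ whose nonzero elements are all logarithmic and each have a unique zero, located at $\infty$, of order $m-1$. Two such spaces $\Omega,\Omega'$ are equivalent if $\Omega'=\sigma^*\Omega$ for some automorphism $\sigma$ of $\mathbb{P}^1_k$ fixing $\infty$ (i.e. $X\mapsto\alpha X+\beta$, $\alpha\neq 0$). The relative Frobenius operator is $\Phi\big(\frac{\sum a_iX^i}{\sum b_iX^i}dX\big)=\frac{\sum a_i^3X^i}{\sum b_i^3X^i}dX$, applied elementwise to a space. For polynomials $Q_1,Q_2$, let $\Omega(Q_1,Q_2)$ be the $\mathbb{F}_3$-span of $\frac{Q_2\,dX}{Q_1^3Q_2-Q_1Q_2^3}$ and $\frac{-Q_1\,dX}{Q_1^3Q_2-Q_1Q_2^3}$.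 Definition of $\Omega_1$: let $\mu\in k$ satisfy $\mu^3-\mu+1=0$; put $P_0=X^5-(\mu^2+\mu+1)X^3-X^2+(\mu^2-\mu-1)X$, $P_\infty=X^5-(\mu^2+\mu)X^3-(\mu+1)X^2-(\mu^2+\mu-1)X-(\mu^2-\mu+1)$, $Q_1=-\mu P_\infty$, $Q_2=(\mu^2-\mu-1)P_0$, and $\Omega_1=\Omega(Q_1,Q_2)$. Definition of $\Omega_2$: let $\mu\in k$ satisfy $\mu^4+\mu^3-\mu^2-\mu-1=0$ and put $a=-\mu^{20}$ (so $a^2=-1$); put $P_0=X^5-X^3-X^2+aX-(a+1)$, $P_\infty=X^5-(a+1)X^3+(a+1)X^2+X+a$, $Q_1=-(a+1)P_\infty$, $Q_2=aP_0$, and $\Omega_2=\Omega(Q_1,Q_2)$. (The paper verifies that $\Omega_1$ and $\Omega_2$ are spaces $L_{15,2}$.) *)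

(* Defs.v *)
From HB Require Import structures.
From mathcomp Require Import all_boot all_order all_algebra.
From mathcomp Require Import boolp classical_sets.
From mathcomp Require Import ring.

Set Implicit Arguments.
Unset Strict Implicit.
Unset Printing Implicit Defensive.

Import Order.TTheory GRing.Theory Num.Theory.
Local Open Scope ring_scope.
Local Open Scope quotient_scope.

Notation "x %:F" := (@FracField.tofrac _ x) : ring_scope.

(* k(X).  The meromorphic form f(X) dX on P^1_k is represented by its
   coefficient f, so the types of rational functions and of forms coincide. *)
Notation ratfun k := {fraction {poly k}}.

Section RationalFunctions.
Variable k : fieldType.
Implicit Types (f g : ratfun k) (p q : {poly k}).

(* Numerator and denominator of a chosen representative, not necessarily in
   lowest terms; every notion below is independent of that choice, see the
   lemmas stated on p%:F / q%:F. *)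
Definition fnum f : {poly k} := \n_(repr f).
Definition fden f : {poly k} := \d_(repr f).

Definition fderiv f : ratfun k :=
  ((fnum f)^`() * fden f - fnum f * (fden f)^`())%:F / (fden f ^+ 2)%:F.

Definition peval p g : ratfun k := (map_poly (fun c : k => c%:P%:F) p).[g].

(* Meaningful when g is not constant (g is transcendental over k, so the
   denominator does not vanish). *)
Definition fcomp f g : ratfun k := peval (fnum f) g / peval (fden f) g.

(* Order of f at the finite point a, for f != 0. *)
Definition ford (a : k) f : int := (mup a (fnum f))%:Z - (mup a (fden f))%:Z.

(* Order at infinity of the form f dX, for f != 0. *)
Definition ford_inf f : int := ford 0 (fcomp f ('X%:F)^-1) - 2.

Definition logarithmic f : Prop :=
  exists F : ratfun k, F != 0 /\ f = fderiv F / F.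

(* g^*(f dX) = f(g) dg *)
Definition pullback g f : ratfun k := fcomp f g * fderiv g.

Definition Phi f : ratfun k :=
  (map_poly (fun c : k => c ^+ 3) (fnum f))%:F /
  (map_poly (fun c : k => c ^+ 3) (fden f))%:F.

End RationalFunctions.

Section Spaces.
Variable k : fieldType.
Local Open Scope classical_set_scope.

(* An element c of 'F_3 acts on a form as multiplication by its natural
   representative; this is the F_3-module structure when k has
   characteristic 3. *)
Definition F3comb (n : nat) (w : n.-tuple (ratfun k)) (c : {ffun 'I_n -> 'F_3})
    : ratfun k :=
  \sum_(i < n) tnth w i *+ c i.

Definition F3span (n : nat) (w : n.-tuple (ratfun k)) : set (ratfun k) :=
  range (F3comb w).

Definition F3free (n : nat) (w : n.-tuple (ratfun k)) : Prop :=
  forall c : {ffun 'I_n -> 'F_3}, F3comb w c = 0 -> forall i, c i = 0.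

(* "Lspace m n Omega" says that Omega is a space L_{m+1,n} (p = 3). *)
Definition Lspace (m n : nat) (Omega : set (ratfun k)) : Prop :=
  (exists w : n.-tuple (ratfun k), F3free w /\ Omega = F3span w) /\
  (forall f, Omega f -> f != 0 ->
     [/\ logarithmic f,
         ford_inf f = m%:Z - 1 &
         forall a : k, ford a f <= 0]).

Definition space_equiv (Omega Omega' : set (ratfun k)) : Prop :=
  exists alpha beta : k, alpha != 0 /\
    Omega' = pullback (alpha *: 'X + beta%:P)%:F @` Omega.

Definition OmegaQ (Q1 Q2 : {poly k}) : set (ratfun k) :=
  let D := (Q1 ^+ 3 * Q2 - Q1 * Q2 ^+ 3)%:F in
  F3span [tuple Q2%:F / D; (- Q1)%:F / D].

Definition Omega1 (mu : k) : set (ratfun k) :=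
  let P0 : {poly k} :=
    'X^5 - (mu ^+ 2 + mu + 1) *: 'X^3 - 'X^2 + (mu ^+ 2 - mu - 1) *: 'X in
  let Pinf : {poly k} :=
    'X^5 - (mu ^+ 2 + mu) *: 'X^3 - (mu + 1) *: 'X^2
      - (mu ^+ 2 + mu - 1) *: 'X - (mu ^+ 2 - mu + 1)%:P in
  OmegaQ (- mu *: Pinf) ((mu ^+ 2 - mu - 1) *: P0).

Definition Omega2 (mu : k) : set (ratfun k) :=
  let a : k := - mu ^+ 20 in
  let P0 : {poly k} := 'X^5 - 'X^3 - 'X^2 + a *: 'X - (a + 1)%:P in
  let Pinf : {poly k} :=
    'X^5 - (a + 1) *: 'X^3 + (a + 1) *: 'X^2 + 'X + a%:P in
  OmegaQ (- (a + 1) *: Pinf) (a *: P0).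

Definition five_spaces (mu1 mu2 : k) : 5.-tuple (set (ratfun k)) :=
  [tuple Omega1 mu1; @Phi k @` Omega1 mu1; @Phi k @` (@Phi k @` Omega1 mu1);
         Omega2 mu2; @Phi k @` Omega2 mu2].

End Spaces.

Section IndependenceOfRepresentative.
Variable k : fieldType.
Implicit Types (f g : ratfun k) (p q : {poly k}).

Lemma fden_neq0 f : fden f != 0.
Proof. exact: denom_ratioP. Qed.

Lemma fnumdenE f : f = (fnum f)%:F / (fden f)%:F.
Proof.
rewrite /fnum /fden -{1}[f]reprK; set r := repr f.
have d0 : \d_r != 0 by exact: denom_ratioP.
have dF0 : (\d_r)%:F != 0 :> ratfun k by rewrite tofrac_eq0.
apply: (mulIf dF0); rewrite divfK // /FracField.tofrac; unlock.
rewrite -[LHS](@FracField.pi_mul {poly k}); apply/eqmodP => /=.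
rewrite /FracField.equivf /FracField.mulf /=.
rewrite !numden_Ratio ?mulf_neq0 ?mulr1 ?oner_neq0 //; try exact: oner_neq0.
by rewrite [X in _ == X]mulrC.
Qed.

Lemma fnumden_cross p q : q != 0 ->
  fnum (p%:F / q%:F) * q = p * fden (p%:F / q%:F).
Proof.
move=> q0; apply/eqP; rewrite -tofrac_eq !tofracM.
have := fnumdenE (p%:F / q%:F); set n := fnum _; set d := fden _ => e.
have dF0 : d%:F != 0 :> ratfun k by rewrite tofrac_eq0 fden_neq0.
have qF0 : q%:F != 0 :> ratfun k by rewrite tofrac_eq0.
by rewrite -(eqr_div _ _ dF0 qF0) -e.
Qed.

Lemma fderiv_frac p q : q != 0 ->
  fderiv (p%:F / q%:F) = (p^`() * q - p * q^`())%:F / (q ^+ 2)%:F.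
Proof.
move=> q0; have := fnumden_cross p q0; have := fden_neq0 (p%:F / q%:F).
rewrite /fderiv; set n := fnum _; set d := fden _ => d0 e.
have e' := congr1 (@deriv k) e; rewrite !derivM in e'.
apply/eqP; rewrite eqr_div ?tofrac_eq0 ?expf_neq0 // -!tofracM tofrac_eq.
apply/eqP.
have -> : (n^`() * d - n * d^`()) * q ^+ 2 =
  d * q * (n^`() * q + n * q^`()) - n * q * (d^`() * q + d * q^`()).
  by ring.
by rewrite e' e; ring.
Qed.

Lemma fnum_neq0 p q : p != 0 -> q != 0 -> fnum (p%:F / q%:F) != 0.
Proof.
move=> p0 q0; apply: contra_neq p0 => n0.
have := fnumden_cross p q0; rewrite n0 mul0r => /esym/eqP.
by rewrite mulf_eq0 (negPf (fden_neq0 _)) orbF => /eqP.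
Qed.

Lemma ford_frac a p q : p != 0 -> q != 0 ->
  ford a (p%:F / q%:F) = (mup a p)%:Z - (mup a q)%:Z.
Proof.
move=> p0 q0; have := congr1 (mup a) (fnumden_cross p q0).
rewrite !mupM ?fnum_neq0 ?fden_neq0 // => /(congr1 Posz); rewrite !PoszD /ford.
by move=> e; apply/eqP; rewrite subr_eq addrAC eq_sym subr_eq e.
Qed.

Lemma pevalM p q g : peval (p * q) g = peval p g * peval q g.
Proof.
by rewrite /peval (rmorphM (map_poly (FracField.tofrac (R:={poly k}) \o polyC))) hornerM.
Qed.

Lemma fcomp_frac p q g : (forall r, r != 0 -> peval r g != 0) -> q != 0 ->
  fcomp (p%:F / q%:F) g = peval p g / peval q g.
Proof.
move=> g_tr q0; apply/eqP.
by rewrite eqr_div ?g_tr ?fden_neq0 // -!pevalM fnumden_cross.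
Qed.

Lemma Phi_frac p q : 3%N \in [pchar k] -> q != 0 ->
  Phi (p%:F / q%:F) = (map_poly (fun c : k => c ^+ 3) p)%:F /
                      (map_poly (fun c : k => c ^+ 3) q)%:F.
Proof.
move=> ch3 q0; pose F := pFrobenius_aut ch3.
have eF r : map_poly (fun c : k => c ^+ 3) r = map_poly F r by [].
have F0 r : r != 0 -> (map_poly F r)%:F != 0 :> ratfun k.
  by rewrite tofrac_eq0 map_poly_eq0.
apply/eqP; rewrite /Phi !eF eqr_div ?F0 ?fden_neq0 //.
by rewrite -!tofracM -!rmorphM /= fnumden_cross.
Qed.

End IndependenceOfRepresentative.

(* Main.v *)
Require Import Defs.
From Stdlib Require Import ZArith Ring Ring_polynom.
From mathcomp Require Import all_boot all_order all_algebra.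
From mathcomp Require Import boolp classical_sets.
From mathcomp Require Import zify ring.
From mathcomp.zify Require Import ssrZ.
From mathcomp.algebra_tactics Require Import common.

Set Implicit Arguments.
Unset Strict Implicit.
Unset Printing Implicit Defensive.

Import GRing.Theory.
Local Open Scope ring_scope.

(* Poles of a space L_{15,2} are simple with residues in F_3, and counting them
   shows that the space is Omega(Q1, Q2) with Q1, Q2 of degree 5 whose leading
   coefficients a, b are F_3-independent. In characteristic 3 a form f dX is
   logarithmic only if f'' = - f^3; for Omega(Q1, Q2) this says that
   (W M)' = -1, where W is the Wronskian and M = Q1^3 Q2 - Q1 Q2^3 the Moore
   determinant.

   Since (a, b) and (a^3, b^3) are independent, one can write
   Q1 = a X + a^3 Y and Q2 = b X + b^3 Y with X monic of degree 5 and deg Y <= 4.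
   As a and b are roots of an additive polynomial T^9 - c T^3 + d T, the equation
   (W M)' = -1 only involves X, Y, c, d: it is invariant under GL_2(F_3).
   The top coefficients allow to translate so that X has no term of degree 4, and
   then deg Y = 3. What remains is a weighted homogeneous system that can be
   solved by hand: up to scaling it has one solution for each root P of
   P^5 + P^3 + P^2 + P + 1 = (P^3 + P^2 - 1) (P^2 - P - 1). A space is determined
   up to equivalence by P, the five spaces of the theorem correspond to the five
   roots, and P can be recovered from the equivalence class. *)

(** * Ring normalisation with coefficients modulo 3 *)

Section Char3Ring.
Variables (R : comPzRingType) (h3 : 3 = 0 :> R).

Definition Zadd3 (a b : Z) := Z.modulo (Z.add a b) (Zpos 3).
Definition Zmul3 (a b : Z) := Z.modulo (Z.mul a b) (Zpos 3).
Definition Zsub3 (a b : Z) := Z.modulo (Z.sub a b) (Zpos 3).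
Definition Zopp3 (a : Z) := Z.modulo (Z.opp a) (Zpos 3).
Definition Zeqb3 (a b : Z) := Z.eqb (Z.modulo a (Zpos 3)) (Z.modulo b (Zpos 3)).

Let phi (n : Z) : R := (int_of_Z n)%:~R.

Lemma phi_mod3 n : phi (Z.modulo n (Zpos 3)) = phi n.
Proof.
rewrite [in RHS](Z.div_mod n (Zpos 3)) //.
rewrite /phi (morph_add (RZ R)) (morph_mul (RZ R)).
by rewrite [X in X * _](_ : _ = 3%:R) // h3 mul0r add0r.
Qed.

(** Since 3 vanishes in [R], reducing after every operation does not change the image of a
    coefficient. The normaliser may therefore compute in F_3 and prove identities that fail over the
    integers. *)
Lemma char3_morph : ring_morph 0 1 +%R *%R (fun x y : R => x - y) -%R eq
  Z0 (Zpos 1) Zadd3 Zmul3 Zsub3 Zopp3 Zeqb3 phi.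
Proof.
split=> //= [x y|x y|x y|x|x y /Z.eqb_eq e]; rewrite ?phi_mod3.
- exact: (morph_add (RZ R)).
- exact: (morph_sub (RZ R)).
- exact: (morph_mul (RZ R)).
- exact: (morph_opp (RZ R)).
- by rewrite -(phi_mod3 x) e phi_mod3.
Qed.

Let RE := Eq_ext +%R *%R (@GRing.opp R).
Let correct3 :=
  Ring_polynom.ring_correct
    (Eqsth R) RE (Rth_ARth (Eqsth R) RE (RR R)) char3_morph (PN R)
    (triv_div_th (Eqsth R) RE (Rth_ARth (Eqsth R) RE (RR R)) char3_morph).

(** Counterpart modulo 3 of the correctness statement behind [ring]. It takes the same reified data,
    so the tactic can be redirected to it; [lpe] holds the equations supplied as rewrite rules. *)
Lemma char3_ring_correct (n : nat) (l : seq R)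
    (lpe : seq (RExpr R * RExpr R * PExpr Z * PExpr Z))
    (re1 re2 : RExpr R) (pe1 pe2 : PExpr Z) :
  Internals.Reval_eqs lpe ->
  (forall R_of_Z zero opp add sub one mul exp,
      Ring.Rnorm R_of_Z zero add opp sub one mul exp id re1 ::
      Ring.Rnorm R_of_Z zero add opp sub one mul exp id re2 ::
      Internals.Rnorm_list R_of_Z zero add opp sub one mul exp lpe =
      PEeval zero one add mul sub opp R_of_Z id exp l pe1 ::
      PEeval zero one add mul sub opp R_of_Z id exp l pe2 ::
      Internals.PEeval_list R_of_Z zero opp add sub one mul exp l lpe) ->
  (let norm pe :=
     norm_subst Z0 (Zpos 1) Zadd3 Zmul3 Zsub3 Zopp3 Zeqb3 (triv_div Z0 (Zpos 1) Zeqb3) n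
       (mk_monpol_list Z0 (Zpos 1) Zadd3 Zmul3 Zsub3 Zopp3 Zeqb3
          (triv_div Z0 (Zpos 1) Zeqb3)
          (map (fun '(_, _, lhs, rhs) => (lhs, rhs)) lpe)) pe
   in Ring_polynom.Peq Zeqb3 (norm pe1) (norm pe2)) ->
  Reval re1 = Reval re2.
Proof.
move=> Hlpe' /(_ phi 0 -%R +%R (fun x y => x - y) 1 *%R
  (fun x n => x ^+ nat_of_N n)) /=.
rewrite -!Ring.Rnorm_correct => -[-> -> Hlpe]; apply: correct3.
elim: lpe Hlpe Hlpe' => [|[[[{}re1 {}re2] {}pe1] {}pe2] lpe IHlpe] //=.
rewrite /= -!Ring.Rnorm_correct //.
by move=> [-> ->] Hlpe [Hpe /(IHlpe Hlpe)] {IHlpe Hlpe} /=; case: lpe.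
Qed.

End Char3Ring.

(* From here on, [ring] computes modulo 3 whenever the context contains a proof of
   [3 = 0] in the ring at hand. *)
Ltac ring_reflection Lem R VarMap Lpe RE1 RE2 PE1 PE2 LpeProofs ::=
  match goal with
  | h : 3%:R = 0 |- _ =>
    exact (@char3_ring_correct _ h 100 VarMap Lpe RE1 RE2 PE1 PE2 LpeProofs
             ltac:(reflexivity) ltac:(vm_compute; reflexivity))
  | _ => ring_reflection_check Lem R VarMap Lpe RE1 RE2 PE1 PE2 LpeProofs
  end.

(** * The coefficient system of the normalised equation *)

Definition wmoore (k : fieldType) (c d : k) (Xp Yp : {poly k}) : {poly k} :=
  (Xp^`() * Yp - Xp * Yp^`()) *
  (Xp ^+ 4 + c *: (Xp * Yp ^+ 3) + d *: Yp ^+ 4).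

Definition quintic (k : fieldType) (P : k) : k :=
  P ^+ 5 + P ^+ 3 + P ^+ 2 + P + 1.

(* Equal to P / (P + 1) on the roots of [quintic]. *)
Definition model_u (k : fieldType) (P : k) : k := P ^+ 3 + P ^+ 2 + P - P ^+ 4 - 1.

(* The constant of [wmoore_deg3_solve] for y2 = 1. *)
Definition model_const (k : fieldType) (P : k) : k := P ^+ 3 - P ^+ 4 - P ^+ 2 + P - 1.

Section Solve.
Variable k : fieldType.
Hypothesis h3 : 3 = 0 :> k.
Let h3P : 3 = 0 :> {poly k}. Proof. by rewrite -[3]polyC_natr h3. Qed.

(** Used through [etrans]: the multipliers form an explicit certificate that the goal is a
    combination of known equations, and a single polynomial identity is left to [ring]. *)
Lemma lincomb2 (a b x y : k) : x = 0 -> y = 0 -> a * x + b * y = 0.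
Proof. by move=> -> ->; rewrite !mulr0 addr0. Qed.

Lemma lincomb4 (a b c d x y z t : k) :
  x = 0 -> y = 0 -> z = 0 -> t = 0 -> a * x + b * y + c * z + d * t = 0.
Proof. by move=> -> -> -> ->; rewrite !mulr0 !addr0. Qed.

(* Cubes have derivative 0, so the derivative of W (X (X^3 + c Y^3) + d Y Y^3) is
   (X^3 + c Y^3) (X W)' + d Y^3 (Y W)'; here [al_j] and [be_j] are the
   coefficients of degree 3j + 1 of X W and Y W, where W is the Wronskian. *)
Lemma wmoore_deriv (x3 x2 x1 x0 y3 y2 y1 y0 c d : k) :
  let Xp := 'X^5 + x3 *: 'X^3 + x2 *: 'X^2 + x1 *: 'X + x0%:P in
  let Yp := y3 *: 'X^3 + y2 *: 'X^2 + y1 *: 'X + y0%:P in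
  let b32 := x3 * y2 - x2 * y3 in
  let b21 := x2 * y1 - x1 * y2 in
  let b31 := x3 * y1 - x1 * y3 in
  let b20 := x2 * y0 - x0 * y2 in
  let b10 := x1 * y0 - x0 * y1 in
  let al3 := y1 - y3 * x3 in
  let be3 := - y3 ^+ 2 in
  let al2 := b21 + (b32 - y0) * x3 + y1 * x2 - y3 * x0 in
  let be2 := (b32 - y0) * y3 + y1 * y2 - y3 * y0 in
  let al1 := (b32 - y0) * x0 + b21 * x2 - b20 * x3 - b31 * x1 in
  let be1 := (b32 - y0) * y0 + b21 * y2 - b20 * y3 - b31 * y1 in
  let al0 := b10 * x1 - b20 * x0 in
  let be0 := b10 * y1 - b20 * y0 in
  let pr x y al be := (x ^+ 3 + c * y ^+ 3) * al + d * y ^+ 3 * be in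
  (wmoore c d Xp Yp)^`() =
    al3 *: 'X^24 + al2 *: 'X^21 + (al1 + pr x3 y3 al3 be3) *: 'X^18
  + (al0 + pr x3 y3 al2 be2 + pr x2 y2 al3 be3) *: 'X^15
  + (pr x3 y3 al1 be1 + pr x2 y2 al2 be2 + pr x1 y1 al3 be3) *: 'X^12
  + (pr x3 y3 al0 be0 + pr x2 y2 al1 be1 + pr x1 y1 al2 be2
     + pr x0 y0 al3 be3) *: 'X^9
  + (pr x2 y2 al0 be0 + pr x1 y1 al1 be1 + pr x0 y0 al2 be2) *: 'X^6
  + (pr x1 y1 al0 be0 + pr x0 y0 al1 be1) *: 'X^3
  + (pr x0 y0 al0 be0)%:P.
Proof.
by cbv zeta; rewrite /wmoore !(derivM, derivE) /= -!mul_polyC; ring.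
Qed.

Lemma sparse_const_coefs (c8 c7 c6 c5 c4 c3 c2 c1 c0 e : k) :
  c8 *: 'X^24 + c7 *: 'X^21 + c6 *: 'X^18 + c5 *: 'X^15 + c4 *: 'X^12
  + c3 *: 'X^9 + c2 *: 'X^6 + c1 *: 'X^3 + c0%:P = e%:P ->
  [/\ c8 = 0, c7 = 0, c6 = 0, c5 = 0 & c4 = 0] /\
  [/\ c3 = 0, c2 = 0, c1 = 0 & c0 = e].
Proof.
move=> E; have C n := congr1 (fun p : {poly k} => p`_n) E.
move: (C 24%N) (C 21%N) (C 18%N) (C 15%N) (C 12%N) (C 9%N) (C 6%N) (C 3%N) (C 0%N).
rewrite !(coefD, coefZ, coefXn, coefC) /= !(mulr0, mulr1, addr0, add0r).
by move=> *; do 2 split.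
Qed.

(** When [Y] has no cubic term, the top equations give [y1 = 0] and kill [al2], [al1], [al0]. The
    constant equation then forces [y0] and [b20] to be nonzero; the remaining ones give [y2 = 0],
    [x3 = 0] and finally [d * y0 ^+ 5 = 0]. *)
Lemma wmoore_deg2_absurd (x3 x2 x1 x0 y2 y1 y0 c d e : k) :
  d != 0 -> e != 0 ->
  (wmoore c d ('X^5 + x3 *: 'X^3 + x2 *: 'X^2 + x1 *: 'X + x0%:P)
     (y2 *: 'X^2 + y1 *: 'X + y0%:P))^`() <> e%:P.
Proof.
move=> d0 e0 E.
have := wmoore_deriv x3 x2 x1 x0 0 y2 y1 y0 c d.
rewrite scale0r add0r => /(etrans (esym E))/esym/sparse_const_coefs.
move=> [[E8 E7 E6 E5 E4] [E3 E2 E1 E0]].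
have y10 : y1 = 0 by rewrite -E8; ring.
subst y1.
have al1 : (x3 * y2 - y0) * x0 - x1 * y2 * x2 - (x2 * y0 - x0 * y2) * x3 = 0.
  by rewrite -E6; ring.
have al0 : x1 * y0 * x1 - (x2 * y0 - x0 * y2) * x0 = 0.
  apply: etrans (lincomb2 1 (- x3 ^+ 3) E5 E7); ring.
have y00 : y0 != 0.
  apply: contra_neq e0 => y00; rewrite -E0; subst y0.
  by apply: etrans (lincomb2 (x0 ^+ 3) 0 al0 al0); ring.
have be0 : (x2 * y0 - x0 * y2) != 0.
  apply: contra_neq e0 => b; rewrite -E0.
  by apply: etrans (lincomb2 (x0 ^+ 3 + c * y0 ^+ 3) (- d * y0 ^+ 4) al0 b); ring.
have y20 : y2 = 0.
  have : d * y0 * (x2 * y0 - x0 * y2) * y2 ^+ 3 = 0.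
    have al2 : - x1 * y2 + (x3 * y2 - y0) * x3 = 0 by rewrite -E7; ring.
    by apply: etrans (lincomb4 (-1) (x1 ^+ 3) (x2 ^+ 3 + c * y2 ^+ 3)
                    (x0 ^+ 3 + c * y0 ^+ 3) E2 al1 al0 al2); ring.
  have nz : d * y0 * (x2 * y0 - x0 * y2) != 0 by rewrite !mulf_neq0.
  by move/eqP; rewrite mulf_eq0 (negPf nz) expf_eq0 /= => /eqP.
subst y2.
have x30 : x3 = 0.
  have : y0 * x3 = 0 by rewrite -[RHS]oppr0 -E7; ring.
  by move/eqP; rewrite mulf_eq0 (negPf y00) => /eqP.
subst x3.
have : d * y0 ^+ 5 = 0.
  by apply: etrans (lincomb4 (-1) (x0 ^+ 3 + c * y0 ^+ 3) (x1 ^+ 3) 0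
                    E1 al1 al0 al0); ring.
by move/eqP; rewrite mulf_eq0 (negPf d0) expf_eq0 (negPf y00).
Qed.

Lemma wmoore_deg3_solve (x3 x2 x1 x0 y2 y1 y0 c d e : k) :
  d != 0 -> e != 0 ->
  (wmoore c d ('X^5 + x3 *: 'X^3 + x2 *: 'X^2 + x1 *: 'X + x0%:P)
     ('X^3 + y2 *: 'X^2 + y1 *: 'X + y0%:P))^`() = e%:P ->
  exists P, let u := model_u P in
  [/\ y2 != 0, quintic P = 0,
      [/\ x3 = P * y2 ^+ 2, x2 = u * y2 ^+ 3, x1 = - u * y2 ^+ 4
         & x0 = u * y2 ^+ 5],
      y1 = P * y2 ^+ 2 /\ y0 = (P + u) * y2 ^+ 3
    & [/\ c = (u + P ^+ 3) * y2 ^+ 6, d = P * u * y2 ^+ 8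
         & e = model_const P * y2 ^+ 26]].
Proof.
move=> d0 e0 E.
have := wmoore_deriv x3 x2 x1 x0 1 y2 y1 y0 c d.
rewrite scale1r => /(etrans (esym E))/esym/sparse_const_coefs {E}.
move=> [[E8 E7 E6 E5 E4] [E3 E2 E1 E0]].
have ? : y1 = x3 by apply: subr0_eq; rewrite -E8; ring.
subst y1; rename x3 into p, x2 into u, x1 into w, y2 into q.
(* The system is homogeneous for the weights 1, 2, 3, 4 of [q], [p], [u], [w]. The unknown [t], of
   weight 3, measures how far [y0] is from [p * q + u], its value on the solutions. *)
have [t yE] : exists t, y0 = t + p * q + u by exists (y0 - p * q - u); ring.
subst y0.
have xE : x0 = - q * w - p * t by apply: subr0_eq; rewrite -[RHS]oppr0 -E7; ring.
subst x0.
have dE : d = q * t * w + q * u * w + p * t ^+ 2 + p * t * u + w ^+ 2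
   - q ^+ 2 * p * w - q * p ^+ 2 * t - q * p ^+ 2 * u - p ^+ 2 * w.
  by apply: subr0_eq; rewrite -[RHS]oppr0 -E6; ring.
have cE : c = p ^+ 3 + t ^+ 2 + t * u
   - q ^+ 3 * t - q ^+ 2 * w - q * p * t - q * p * u - p * w.
  apply: (mulfI d0); apply: subr0_eq.
  by apply: etrans (lincomb4 1 (- p ^+ 3 - c) 0 0 E4 E6 E6 E6); ring.
(* The equations in degrees 9, 6 and 3 are divisible by [d] modulo [E5] and [E6]; the quotients have
   weights 9, 12 and 15, whence the names. *)
have e9 : q ^+ 6 * t + q ^+ 3 * p ^+ 3 + q ^+ 3 * p * w + q ^+ 3 * t * u
    + q * p * t * u + q * p * u ^+ 2 + p * u * w + t ^+ 3 + t ^+ 2 * u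
    + t * u ^+ 2 - q ^+ 5 * w - q ^+ 4 * p * t - q ^+ 4 * p * u
    - q ^+ 3 * t ^+ 2 - q ^+ 2 * p ^+ 2 * t - q ^+ 2 * p ^+ 2 * u
    - q ^+ 2 * u * w - q * p ^+ 2 * w - p * t * w - u ^+ 3 = 0.
  apply: (mulfI d0); rewrite mulr0.
  by apply: etrans (lincomb4 1 (- p ^+ 3 - c) (- u ^+ 3 - c * q ^+ 3) 0
                      E3 E5 E6 E6); rewrite cE; ring.
have e12 : q ^+ 6 * p ^+ 3 + q ^+ 6 * p * w + q ^+ 6 * t * u + q ^+ 4 * p * t * u
    + q ^+ 4 * p * u ^+ 2 + q ^+ 3 * p * u * w + q ^+ 3 * t ^+ 2 * u
    + q ^+ 3 * t * u ^+ 2 + t ^+ 4 + w ^+ 3 - q ^+ 9 * t - q ^+ 8 * w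
    - q ^+ 7 * p * t - q ^+ 7 * p * u - q ^+ 6 * t ^+ 2
    - q ^+ 5 * p ^+ 2 * t - q ^+ 5 * p ^+ 2 * u - q ^+ 5 * u * w
    - q ^+ 4 * p ^+ 2 * w - q ^+ 3 * p * t * w - q ^+ 3 * t ^+ 3 = 0.
  apply: (mulfI d0); rewrite mulr0.
  by apply: etrans (lincomb4 1 (- u ^+ 3 - c * q ^+ 3)
                      (- w ^+ 3 - c * p ^+ 3) 0 E2 E5 E6 E6); rewrite cE; ring.
have e15 : q ^+ 6 * p ^+ 3 * t + q ^+ 3 * p ^+ 6 + q ^+ 3 * p ^+ 4 * w
    + q ^+ 3 * p ^+ 3 * t * u + q * p ^+ 4 * t * u
    + q * p ^+ 4 * u ^+ 2 + p ^+ 4 * u * w + p ^+ 3 * t ^+ 3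
    + p ^+ 3 * t ^+ 2 * u + p ^+ 3 * t * u ^+ 2 - q ^+ 5 * p ^+ 3 * w
    - q ^+ 4 * p ^+ 4 * t - q ^+ 4 * p ^+ 4 * u
    - q ^+ 3 * p ^+ 3 * t ^+ 2 - q ^+ 3 * t ^+ 4 - q ^+ 3 * t * u ^+ 3
    - q ^+ 2 * p ^+ 5 * t - q ^+ 2 * p ^+ 5 * u
    - q ^+ 2 * p ^+ 3 * u * w - q * p ^+ 5 * w - p ^+ 4 * t * w
    - p ^+ 3 * u ^+ 3 - t * w ^+ 3 = 0.
  apply: (mulfI d0); rewrite mulr0.
  by apply: etrans (lincomb4 1 (- w ^+ 3 - c * p ^+ 3)
                      (- (- q * w - p * t) ^+ 3 - c * (t + p * q + u) ^+ 3) 0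
                      E1 E5 E6 E6); rewrite cE; ring.
(* Most terms cancel in these two combinations and cubes remain. They give [q * (t + u) + w = 0]:
   from [z1] if [t] is nonzero, from [z2] if [t = 0]. *)
have z1 : t * (q * (t + u) + w) ^+ 3 = 0.
  by apply: etrans (lincomb2 (p ^+ 3) (-1) e9 e15); ring.
have z2 : (q * (t + u) + w) ^+ 3 + t * (q ^+ 3 + t) ^+ 3 = 0.
  by apply: etrans (lincomb2 (- q ^+ 3) 1 e9 e12); ring.
have wE : w = - q * (t + u).
  apply: subr0_eq; rewrite mulNr opprK addrC; apply/eqP.
  move/eqP: z1; rewrite mulf_eq0 => /orP[/eqP t0|]; last by rewrite expf_eq0.
  by move/eqP: z2; rewrite t0 mul0r addr0 expf_eq0.
subst w.
(* What is left of [z2] allows only [t = 0] or [t = - q ^+ 3], and the second value makes [d]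
   vanish. *)
have t0 : t = 0.
  apply/eqP; apply: contraNT d0 => t0.
  have : t * (q ^+ 3 + t) ^+ 3 = 0 by rewrite -z2; ring.
  move/eqP; rewrite mulf_eq0 (negPf t0) expf_eq0 /= => /eqP tE.
  have {}tE : t = - q ^+ 3 by apply: subr0_eq; rewrite -tE; ring.
  by rewrite dE; apply/eqP; rewrite tE; ring.
subst t.
have : d = q ^+ 3 * p * u by rewrite dE; ring.
move=> dE'; have := d0; rewrite dE' mulf_eq0 mulf_eq0 expf_eq0 /= !negb_or.
move=> /andP[/andP[q0 p0] u0].
have [P pE] : exists P, p = P * q ^+ 2 by exists (p / q ^+ 2); rewrite divfK // expf_neq0.
have [U uE] : exists U, u = U * q ^+ 3 by exists (u / q ^+ 3); rewrite divfK // expf_neq0.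
subst p u.
have P0 : P != 0 by apply: contraNneq p0 => ->; rewrite mul0r.
have U0 : U != 0 by apply: contraNneq u0 => ->; rewrite mul0r.
have UP : (P + 1) * U - P = 0.
  apply: (mulfI (mulf_neq0 U0 (expf_neq0 11 q0))); rewrite mulr0.
  by apply: etrans (lincomb2 1 0 E5 E5); rewrite dE'; ring.
have E9 : P + P ^+ 3 + U ^+ 2 - U ^+ 3 = 0.
  apply: (mulfI (expf_neq0 9 q0)); rewrite mulr0.
  by apply: etrans (lincomb2 1 (- q ^+ 9) e9 UP); ring.
(* Substituting [U = P / (P + 1)] in [E9] and multiplying by [(P + 1) ^+ 3] gives
   [P * quintic P]. *)
have QP : quintic P = 0.
  apply: (mulfI P0); rewrite mulr0 /quintic.
  by apply: etrans (lincomb2 ((P + 1) ^+ 3)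
    ((P + 1) ^+ 2 * U ^+ 2 + (P + 1) * U * P + P ^+ 2 - (P + 1) ^+ 2 * U
     - (P + 1) * P) E9 UP); ring.
have P1 : P + 1 != 0.
  by apply: contra_neq P0 => P1; apply/eqP; rewrite -oppr_eq0 -UP P1; apply/eqP; ring.
have {}uE : U = model_u P.
  apply: (mulfI P1); rewrite -[LHS]subr0 -UP; apply: subr0_eq.
  by apply: etrans (lincomb2 1 0 QP QP); rewrite /quintic /model_u; ring.
rewrite uE in E0 dE'; exists P => /=; rewrite -uE; split=> //.
- by split=> //; ring.
- by split=> //; ring.
- split; [by rewrite cE; ring | by ring |].
  have {}QP : P ^+ 5 = - P ^+ 3 - P ^+ 2 - P - 1.
    by apply: subr0_eq; rewrite -QP /quintic; ring.
  by rewrite -E0 cE uE dE' /model_const /model_u; ring: QP.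
Qed.

End Solve.

(** * Reduction of a pair of quintics to the normal form *)

Definition wronskian (k : fieldType) (Q1 Q2 : {poly k}) : {poly k} :=
  Q1^`() * Q2 - Q1 * Q2^`().

Definition moore (R : pzRingType) (x y : R) : R := x ^+ 3 * y - x * y ^+ 3.

(** This is [a X + a^3 Y] for the solution of [wmoore_deg3_solve] with [y2 = q]; [y] is the leading
    coefficient of [Y] before it is made monic. *)
Definition model_poly (k : fieldType) (q y P a : k) : {poly k} :=
  let u := model_u P in
  a *: ('X^5 + (P * q ^+ 2) *: 'X^3 + (u * q ^+ 3) *: 'X^2
        + (- u * q ^+ 4) *: 'X + (u * q ^+ 5)%:P)
  + (a ^+ 3 * y) *: ('X^3 + q *: 'X^2 + (P * q ^+ 2) *: 'X
        + ((P + u) * q ^+ 3)%:P).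

(* [a] is a root of T^9 - c T^3 + d T, where c and d are the values forced by
   [wmoore_deg3_solve]. *)
Definition model_root (k : fieldType) (q y P a : k) : Prop :=
  let u := model_u P in
  y ^+ 4 * a ^+ 9 = (u + P ^+ 3) * q ^+ 6 * y * a ^+ 3 - P * u * q ^+ 8 * a.

(** The equation for [y ^+ 3] results from eliminating [d] between
    [d * y ^+ 4 = P * model_u P * q ^+ 8] and [d^-1 = model_const P * q ^+ 26 * y], where
    [d = moore a b ^+ 2]. *)
Definition model (k : fieldType) (q y P a b : k) : Prop :=
  [/\ quintic P = 0, q != 0, y != 0, y ^+ 3 = model_const P * P * model_u P * q ^+ 34 &
      [/\ moore a b != 0, model_root q y P a & model_root q y P b]].

Section Reduction.
Variable k : fieldType.
Hypothesis h3 : 3 = 0 :> k.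
Let h3P : 3 = 0 :> {poly k}. Proof. by rewrite -[3]polyC_natr h3. Qed.

Lemma scale_polyC (a b : k) : a *: b%:P = (a * b)%:P.
Proof. by rewrite -mul_polyC polyCM. Qed.

Lemma coefM_top (p q : {poly k}) m n : (size p <= m.+1)%N ->
  (size q <= n.+1)%N -> (p * q)`_(m + n) = p`_m * q`_n.
Proof.
move=> sp sq; have mlt : (m < (m + n).+1)%N by rewrite ltnS leq_addr.
rewrite coefM (bigD1 (Ordinal mlt)) //= addKn big1 ?addr0 // => i /eqP ni.
case: (ltngtP i m) => im.
- by rewrite [q`__]nth_default ?mulr0 // (leq_trans sq) //; lia.
- by rewrite [p`__]nth_default ?mul0r // (leq_trans sp).
- by case: ni; apply/val_inj.
Qed.

Lemma poly_sum6 (p : {poly k}) : (size p <= 6)%N ->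
  p = p`_5 *: 'X^5 + p`_4 *: 'X^4 + p`_3 *: 'X^3 + p`_2 *: 'X^2 + p`_1 *: 'X
      + (p`_0)%:P.
Proof.
move=> sp; apply/polyP=> i; rewrite !(coefD, coefZ, coefXn, coefX, coefC).
case: i => [|[|[|[|[|[|i]]]]]] /=; rewrite ?mulr0 ?mulr1 ?addr0 ?add0r //.
by rewrite nth_default // (leq_trans sp).
Qed.

Lemma comp_shift6 (p : {poly k}) (z : k) : (size p <= 6)%N ->
  exists c2 c1 c0 : k, p \Po ('X + z%:P) = p`_5 *: 'X^5 + (p`_4 - z * p`_5) *: 'X^4
    + (p`_3 + z * p`_4 + z ^+ 2 * p`_5) *: 'X^3 + c2 *: 'X^2 + c1 *: 'X + c0%:P.
Proof.
move=> sp; move: (p`_5) (p`_4) (p`_3) (p`_2) (p`_1) (p`_0) (poly_sum6 sp).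
move=> a5 a4 a3 a2 a1 a0 ->.
exists (a5 * z ^+ 3 + a2).
exists (- a5 * z ^+ 4 + a4 * z ^+ 3 - a2 * z + a1).
exists (a5 * z ^+ 5 + a4 * z ^+ 4 + a3 * z ^+ 3 + a2 * z ^+ 2 + a1 * z + a0).
rewrite !comp_polyD !comp_polyZ !comp_Xn_poly comp_polyX comp_polyC -!mul_polyC.
ring.
Qed.

Lemma wmoore_comp (c d z : k) (Xp Yp : {poly k}) :
  wmoore c d (Xp \Po ('X + z%:P)) (Yp \Po ('X + z%:P)) =
  wmoore c d Xp Yp \Po ('X + z%:P).
Proof.
have dz : ('X + z%:P)^`() = 1 :> {poly k} by rewrite derivD derivX derivC addr0.
rewrite /wmoore !deriv_comp dz !mulr1.
by rewrite comp_polyM comp_polyB !comp_polyD !comp_polyZ !comp_polyM.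
Qed.

(** The degree 8 coefficient of the Wronskian is [(5 - 4) Y_4], that of degree 20 in the other
    factor is 1, and 28 = 1 modulo 3. A constant derivative thus forces [Y_4 = 0]. *)
Lemma wmoore_coef27 (c d : k) (Xp Yp : {poly k}) :
  (size Xp <= 6)%N -> Xp`_5 = 1 -> (size Yp <= 5)%N ->
  (wmoore c d Xp Yp)^`()`_27 = Yp`_4.
Proof.
move=> sX X5 sY.
have sX' : (size Xp^`() <= 5)%N by rewrite (leq_trans (size_poly _ _)) // -subn1 leq_subLR.
have sY' : (size Yp^`() <= 4)%N by rewrite (leq_trans (size_poly _ _)) // -subn1 leq_subLR.
have sM (p q : {poly k}) m n : (size p <= m.+1)%N -> (size q <= n.+1)%N ->
    (size (p * q)%R <= (m + n).+1)%N.
  move=> sp sq; apply: leq_trans (size_polyMleq _ _) _.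
  by move: sp sq; lia.
have sY3 : (size (Yp ^+ 3) <= 13)%N by rewrite exprS expr2 (sM _ _ 4 8) ?(sM _ _ 4 4).
have sX3 : (size (Xp ^+ 3) <= 16)%N by rewrite exprS expr2 (sM _ _ 5 10) ?(sM _ _ 5 5).
have sX2 : (size (Xp * Xp)%R <= 11)%N by rewrite (sM _ _ 5 5).
rewrite /wmoore; set W := _ - _; set M := _ + _ + _.
have sW : (size W <= 9)%N.
  apply: leq_trans (size_polyD _ _) _; rewrite size_polyN geq_max.
  by rewrite (sM _ _ 4 4) // (sM _ _ 5 3).
have W8 : W`_8 = Yp`_4.
  rewrite coefB (@coefM_top _ _ 4 4) // (@coefM_top _ _ 5 3) // !coef_deriv X5.
  by ring.
have sXY : (size (c *: (Xp * Yp ^+ 3)) <= 18)%N.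
  by rewrite (leq_trans (size_scale_leq _ _)) // (sM _ _ 5 12).
have sY4 : (size (d *: Yp ^+ 4) <= 17)%N.
  by rewrite (leq_trans (size_scale_leq _ _)) // exprS (sM _ _ 4 12).
have sM' : (size M <= 21)%N.
  apply: leq_trans (size_polyD _ _) _; rewrite geq_max.
  rewrite (leq_trans sY4) // andbT.
  apply: leq_trans (size_polyD _ _) _; rewrite geq_max.
  by rewrite (leq_trans sXY) // exprS (sM _ _ 5 15).
have M20 : M`_20 = 1.
  have XY0 : (c *: (Xp * Yp ^+ 3))`_20 = 0.
    by rewrite nth_default // (leq_trans sXY).
  have Y0 : (d *: Yp ^+ 4)`_20 = 0 by rewrite nth_default // (leq_trans sY4).
  rewrite !coefD XY0 Y0 !addr0.
  rewrite exprS (@coefM_top _ _ 5 15) // exprS (@coefM_top _ _ 5 10) //.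
  by rewrite expr2 (@coefM_top _ _ 5 5) // X5 !mulr1.
by rewrite coef_deriv (@coefM_top W M 8 20) // W8 M20; ring.
Qed.

Lemma wmooreZ (c d y : k) (Xp Yp : {poly k}) :
  wmoore c d Xp (y *: Yp) = y *: wmoore (c * y ^+ 3) (d * y ^+ 4) Xp Yp.
Proof. by rewrite /wmoore derivZ -!mul_polyC; ring. Qed.

Lemma wmoore_model (c d e : k) (Xp Yp : {poly k}) :
  (size Xp <= 6)%N -> Xp`_5 = 1 -> (size Yp <= 5)%N -> d != 0 -> e != 0 ->
  (wmoore c d Xp Yp)^`() = e%:P ->
  exists z q y P : k, [/\ [/\ quintic P = 0, q != 0 & y != 0],
    [/\ c * y ^+ 3 = (model_u P + P ^+ 3) * q ^+ 6,
        d * y ^+ 4 = P * model_u P * q ^+ 8 & e = model_const P * q ^+ 26 * y] &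
    forall a, a *: (Xp \Po ('X + z%:P)) + a ^+ 3 *: (Yp \Po ('X + z%:P)) =
              model_poly q y P a].
Proof.
move=> sX X5 sY d0 e0 E.
have Y4 : Yp`_4 = 0 by rewrite -(wmoore_coef27 c d sX X5 sY) E coefC.
have Y5 : Yp`_5 = 0 by rewrite nth_default.
(* As 5 = -1 in [k], translating by the coefficient of degree 4 itself removes it from the monic
   [Xp]. *)
pose z := Xp`_4; exists z.
have [x2 [x1 [x0 Xz]]] := comp_shift6 z sX.
have [y2 [y1 [y0 Yz]]] := comp_shift6 z (leq_trans sY (leqnSn 5)).
move: Xz Yz; rewrite X5 Y4 Y5.
rewrite !(mulr0, mulr1, addr0, subrr, subr0, oppr0, scale0r, scale1r, add0r).
set x3 := Xp`_3 + _ + _; set y3 := Yp`_3 => Xz Yz.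
have {}E : (wmoore c d (Xp \Po ('X + z%:P)) (Yp \Po ('X + z%:P)))^`() = e%:P.
  rewrite wmoore_comp deriv_comp E comp_polyC derivD derivX derivC addr0.
  by rewrite mulr1.
rewrite Xz Yz in E *.
have [y30|y30] := eqVneq y3 0.
  rewrite y30 scale0r add0r in E.
  by have := wmoore_deg2_absurd h3 d0 e0 E.
pose t2 := y2 / y3; pose t1 := y1 / y3; pose t0 := y0 / y3.
have YE : y3 *: 'X^3 + y2 *: 'X^2 + y1 *: 'X + y0%:P =
    y3 *: ('X^3 + t2 *: 'X^2 + t1 *: 'X + t0%:P).
  rewrite !scalerDr !scalerA scale_polyC /t2 /t1 /t0.
  by rewrite ![y3 * (_ / _)]mulrC !divfK.
rewrite YE wmooreZ derivZ in E *.
have {}E : (wmoore (c * y3 ^+ 3) (d * y3 ^+ 4)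
    ('X^5 + x3 *: 'X^3 + x2 *: 'X^2 + x1 *: 'X + x0%:P)
    ('X^3 + t2 *: 'X^2 + t1 *: 'X + t0%:P))^`() = (e / y3)%:P.
  by apply: (scalerI y30); rewrite E scale_polyC mulrC divfK.
have [||P /= [q0 QP [-> -> -> ->] [-> ->] [cE dE eE]]] := wmoore_deg3_solve h3 _ _ E.
- by rewrite mulf_neq0 // expf_neq0.
- by rewrite mulf_neq0 // invr_eq0.
exists t2, y3, P; split=> //; first split=> //.
  by rewrite -eE divfK.
by move=> a; rewrite /model_poly scalerA.
Qed.

Lemma cubeB (p q : {poly k}) : (p - q) ^+ 3 = p ^+ 3 - q ^+ 3.
Proof. by ring. Qed.

Lemma pair_model (Q1 Q2 : {poly k}) : (size Q1 <= 6)%N -> (size Q2 <= 6)%N ->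
  moore Q1`_5 Q2`_5 != 0 -> (wronskian Q1 Q2 * moore Q1 Q2)^`() = - 1 ->
  exists z q y P : k, [/\ model q y P Q1`_5 Q2`_5,
    Q1 \Po ('X + z%:P) = model_poly q y P Q1`_5
    & Q2 \Po ('X + z%:P) = model_poly q y P Q2`_5].
Proof.
set a := Q1`_5; set b := Q2`_5 => s1 s2 m0 E.
(* [T^9 - c T^3 + d T] is the additive polynomial whose roots are the F_3-combinations of [a] and
   [b]. Its coefficients, like [Xp] and [Yp] below, come from Cramer's rule with determinant [m]. *)
pose m := moore a b; pose d := m ^+ 2; pose c := (a ^+ 9 * b - a * b ^+ 9) / m.
pose Xp := m^-1 *: (a ^+ 3 *: Q2 - b ^+ 3 *: Q1).
pose Yp := m^-1 *: (b *: Q1 - a *: Q2).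
have Q1E : Q1 = a *: Xp + a ^+ 3 *: Yp.
  apply: (scalerI m0); rewrite /Xp /Yp scalerDr !scalerA.
  rewrite ![_ * _ * m^-1]mulrAC [m * m^-1]mulrC mulVf //.
  rewrite -!mul_polyC !mul1r /m /moore; ring.
have Q2E : Q2 = b *: Xp + b ^+ 3 *: Yp.
  apply: (scalerI m0); rewrite /Xp /Yp scalerDr !scalerA.
  rewrite ![_ * _ * m^-1]mulrAC [m * m^-1]mulrC mulVf //.
  rewrite -!mul_polyC !mul1r /m /moore; ring.
have aE : a ^+ 9 = c * a ^+ 3 - d * a.
  apply: (mulIf (m0 : m != 0)); rewrite mulrBl [c * _ * m]mulrAC /c divfK //.
  by rewrite /d /m /moore; ring.
have bE : b ^+ 9 = c * b ^+ 3 - d * b.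
  apply: (mulIf (m0 : m != 0)); rewrite mulrBl [c * _ * m]mulrAC /c divfK //.
  by rewrite /d /m /moore; ring.
have sX : (size Xp <= 6)%N.
  rewrite (leq_trans (size_scale_leq _ _)) // (leq_trans (size_polyD _ _)) //.
  by rewrite size_polyN geq_max !(leq_trans (size_scale_leq _ _)).
have X5 : Xp`_5 = 1.
  by rewrite coefZ coefB !coefZ -/a -/b -[RHS](mulVf m0) /moore; congr (_ * _); ring.
have sY : (size Yp <= 5)%N.
  apply/leq_sizeP => j; rewrite leq_eqVlt => /orP[/eqP <-|j5].
    by rewrite coefZ coefB !coefZ -/a -/b [b * a]mulrC subrr mulr0.
  rewrite coefZ coefB !coefZ !nth_default ?mulr0 ?subr0 ?mulr0 //.
    exact: leq_trans s2 j5.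
  exact: leq_trans s1 j5.
have d0 : d != 0 by rewrite expf_neq0.
(* Passing from [(Q1, Q2)] to [(Xp, Yp)] takes a factor [- m] out of the Wronskian and, once [aE]
   and [bE] have removed the ninth powers, a factor [m] out of [moore]. Their product is [- d]. *)
have {}E : (wmoore c d Xp Yp)^`() = (d^-1)%:P.
  apply: (scalerI d0); rewrite -derivZ scale_polyC mulfV //.
  apply: oppr_inj; rewrite -derivN -[RHS]E; congr (_^`()).
  have aE' : a%:P ^+ 9 = c%:P * a%:P ^+ 3 - d%:P * a%:P.
    by rewrite -!(rmorphXn, rmorphM, rmorphB) /= aE.
  have bE' : b%:P ^+ 9 = c%:P * b%:P ^+ 3 - d%:P * b%:P.
    by rewrite -!(rmorphXn, rmorphM, rmorphB) /= bE.
  have mE : moore Q1 Q2 = m%:P * (Xp ^+ 4 + c *: (Xp * Yp ^+ 3) + d *: Yp ^+ 4).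
    rewrite /moore Q1E Q2E -!mul_polyC !rmorphXn /=.
    have -> : (a%:P * Xp + a%:P ^+ 3 * Yp) ^+ 3 =
      a%:P ^+ 3 * Xp ^+ 3 + a%:P ^+ 9 * Yp ^+ 3 by ring.
    have -> : (b%:P * Xp + b%:P ^+ 3 * Yp) ^+ 3 =
      b%:P ^+ 3 * Xp ^+ 3 + b%:P ^+ 9 * Yp ^+ 3 by ring.
    by rewrite aE' bE' /d /m /moore; ring.
  have wE : wronskian Q1 Q2 = - m%:P * (Xp^`() * Yp - Xp * Yp^`()).
    by rewrite /wronskian Q1E Q2E !derivE -!mul_polyC /m /moore; ring.
  by rewrite mE wE /wmoore /d -!mul_polyC; ring.
have e0 : d^-1 != 0 by rewrite invr_eq0.
have [z [q [y [P [[QP q0 y0] [cE dE eE] modE]]]]] := wmoore_model sX X5 sY d0 e0 E.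
exists z, q, y, P; split.
- split=> //.
    apply: (mulfI (mulf_neq0 d0 y0)).
    have -> : d * y * y ^+ 3 = P * model_u P * q ^+ 8 by rewrite -dE; ring.
    rewrite -[LHS]mul1r -(mulfV d0) eE; ring.
  split=> //; rewrite /model_root.
    by rewrite aE -cE -dE; ring.
  by rewrite bE -cE -dE; ring.
- by rewrite -modE {1}Q1E comp_polyD; congr (_ + _); apply: comp_polyZ.
- by rewrite -modE {1}Q2E comp_polyD; congr (_ + _); apply: comp_polyZ.
Qed.

End Reduction.

(** * From logarithmic forms to a pair of quintics *)

Lemma closed_nth_root (k : closedFieldType) (c : k) n : (0 < n)%N ->
  exists s, s ^+ n = c.
Proof.
move=> n0; have /closed_rootP[s] : size ('X^n - c%:P) != 1%N.
  by rewrite size_XnsubC // eqSS -lt0n.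
by rewrite rootE !hornerE subr_eq0 => /eqP <-; exists s.
Qed.

(** Any three of the four sizes add up to 18, so all four are equal. Size 6 is degree 5. *)
Lemma degrees_eq5 (a b s d : nat) :
  ((s + d + a).-2 = 16)%N -> ((s + d + b).-2 = 16)%N ->
  ((d + a + b).-2 = 16)%N -> ((s + a + b).-2 = 16)%N ->
  [/\ a = 6%N, b = 6%N, s = 6%N & d = 6%N].
Proof. by move=> *; split; lia. Qed.

Lemma logderiv_cross (F : fieldType) (p m n d : F) : p != 0 -> n != 0 -> d != 0 ->
  p^-1 = m / d ^+ 2 / (n / d) -> p * m = n * d.
Proof.
move=> p0 n0 d0 e; rewrite -[RHS]mul1r -(mulfV p0) e.
by field; rewrite n0 d0.
Qed.

Section Forms.
Variable k : closedFieldType.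
Implicit Types (f g : ratfun k) (p q : {poly k}).

Lemma frac_coprime f : exists p q, [/\ q != 0, coprimep p q & f = p%:F / q%:F].
Proof.
have d0 := fden_neq0 f; have fE := fnumdenE f.
move: (fnum f) (fden f) d0 fE => n d d0 fE.
have g0 : gcdp n d != 0 by rewrite gcdp_eq0 negb_and d0 orbT.
exists (n %/ gcdp n d), (d %/ gcdp n d).
have nE := divpK (dvdp_gcdl n d); have dE := divpK (dvdp_gcdr n d).
have q0 : d %/ gcdp n d != 0 by apply: contraNneq d0 => e; rewrite -dE e mul0r.
split=> //; first by apply: coprimep_div_gcd; rewrite d0 orbT.
rewrite fE; apply/eqP; rewrite eqr_div ?tofrac_eq0 // -!tofracM; apply/eqP.
congr (_%:F); apply: (@etrans _ _ (n %/ gcdp n d * gcdp n d * (d %/ gcdp n d))).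
  by rewrite nE.
by rewrite -mulrA [gcdp n d * _]mulrC dE.
Qed.

(** The numerator is the reversed polynomial, whose constant term is the leading coefficient of [p].
    For nonzero [p] the whole order at infinity therefore sits in the power of ['X]. *)
Lemma peval_inv (p : {poly k}) :
  peval p ('X%:F)^-1 =
  (\sum_(i < size p) p`_i *: 'X^((size p).-1 - i))%:F / ('X^((size p).-1))%:F.
Proof.
have X0 : 'X%:F != 0 :> ratfun k by rewrite tofrac_eq0 polyX_eq0.
have Xn0 n : ('X^n)%:F != 0 :> ratfun k by rewrite tofracXn expf_neq0.
have key : peval p ('X%:F)^-1 * ('X^((size p).-1))%:F =
    (\sum_(i < size p) p`_i *: 'X^((size p).-1 - i))%:F.
  rewrite /peval /map_poly horner_poly mulr_suml.
  rewrite rmorph_sum /=; apply: eq_bigr => i _.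
  have ile : (i <= (size p).-1)%N by rewrite -ltnS (leq_trans (ltn_ord i)) ?leqSpred.
  rewrite -mul_polyC tofracM -mulrA; congr (_ * _).
  rewrite -{1}(subnK ile) exprD tofracM !tofracXn mulrCA -exprMn mulVf //.
  by rewrite expr1n mulr1.
exact: (canRL (mulfK (Xn0 _)) key).
Qed.

Lemma rev_coef0 p : p != 0 ->
  ~~ root (\sum_(i < size p) p`_i *: 'X^((size p).-1 - i)) 0.
Proof.
rewrite -size_poly_gt0 => p0.
have e : (size p).-1.+1 = size p by rewrite prednK.
rewrite rootE -e big_ord_recr /= subnn hornerD horner_sum.
rewrite big1 ?add0r => [|i _].
  by rewrite !hornerE -lead_coefE lead_coef_eq0 -size_poly_gt0.
by rewrite hornerZ hornerXn expr0n subn_eq0 leqNgt ltn_ord mulr0.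
Qed.

Lemma peval_inv_neq0 p : p != 0 -> peval p ('X%:F)^-1 != 0.
Proof.
move=> p0; rewrite peval_inv mulf_neq0 ?invr_eq0 ?tofrac_eq0 ?expf_neq0 ?polyX_eq0 //.
by apply: contraNneq (rev_coef0 p0) => ->; rewrite root0.
Qed.

Lemma ford_inf_inv p : p != 0 -> ford_inf (p%:F)^-1 = ((size p).-1)%:Z - 2.
Proof.
move=> p0; rewrite /ford_inf -[_^-1]mul1r -tofrac1 fcomp_frac //; last exact: peval_inv_neq0.
have -> : peval 1 ('X%:F)^-1 = 1 :> ratfun k.
  by rewrite peval_inv size_poly1 big_ord1 coef1 scale1r !expr0 divff ?tofrac_eq0 ?oner_eq0.
rewrite peval_inv mul1r invf_div ford_frac ?expf_neq0 ?polyX_eq0 //; last first.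
  by apply: contraNneq (rev_coef0 p0) => ->; rewrite root0.
rewrite (mupNroot (rev_coef0 p0)) subr0.
by have := @mup_XsubCX k (size p).-1 0 0; rewrite eqxx subr0 => ->.
Qed.

(** A root of the reduced numerator would be a finite zero; [k] being algebraically closed, the
    numerator is constant. *)
Lemma form_inv f : f != 0 -> (forall a, ford a f <= 0) ->
  exists2 p, p != 0 & f = (p%:F)^-1.
Proof.
move=> f0 hf; have [n [d [d0 cnd fE]]] := frac_coprime f.
have n0 : n != 0 by apply: contraNneq f0 => e; rewrite fE e tofrac0 mul0r.
have : size n == 1%N.
  apply/negPn/negP => /closed_rootP[a ra].
  have := hf a; rewrite fE ford_frac // (mupNroot (coprimep_root cnd ra)) subr0.
  by rewrite lez_nat leqNgt mup_geq // expr1 dvdp_XsubCl ra.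
move/size_poly1P => [c c0 nE]; exists (c^-1 *: d).
  by rewrite scaler_eq0 invr_eq0 negb_or c0.
rewrite fE nE -mul_polyC tofracM invfM; congr (_ * _).
apply: (@mulIf _ (c^-1)%:P%:F); first by rewrite tofrac_eq0 polyC_eq0 invr_eq0.
rewrite mulVf ?tofrac_eq0 ?polyC_eq0 ?invr_eq0 //.
by rewrite -tofracM -polyCM divff.
Qed.

Hypothesis h3 : 3 = 0 :> k.
Let h3P : 3 = 0 :> {poly k}. Proof. by rewrite -[3]polyC_natr h3. Qed.

(** For nonzero [p], this is the condition [f'' = - f^3] for [f = 1/p] after clearing denominators,
    with 2 = -1. *)
Definition logpoly p : Prop := p * p^`()^`() + p^`() ^+ 2 = 1.

Lemma deriv3 p : p^`()^`()^`() = 0.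
Proof.
have -> : p^`()^`()^`() = p^`(3) by [].
have e : (3`!)%:R = 0 :> {poly k} by rewrite (natrM _ 3 2) h3P mul0r.
by rewrite nderivn_def -mulr_natr e mulr0.
Qed.

(* In characteristic 3, n/d and n d^2 have the same logarithmic derivative. *)
Lemma logarithmic_inv p : p != 0 -> logarithmic (p%:F)^-1 -> logpoly p.
Proof.
move=> p0 [F [F0 fE]].
have d0 := fden_neq0 F; have FE := fnumdenE F; rewrite /fderiv in fE.
move: (fnum F) (fden F) d0 FE fE => n d d0 FE fE.
have n0 : n != 0 by apply: contraNneq F0 => e; rewrite FE e tofrac0 mul0r.
have {fE FE}E : p * (n^`() * d - n * d^`()) = n * d.
  have F'0 : forall r : {poly k}, r != 0 -> r%:F != 0 :> ratfun k.
    by move=> r; rewrite tofrac_eq0.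
  apply/eqP; rewrite -tofrac_eq !tofracM; apply/eqP.
  rewrite FE tofracXn in fE.
  exact: (logderiv_cross (F'0 _ p0) (F'0 _ n0) (F'0 _ d0) fE).
pose A := n * d ^+ 2.
have A0 : A != 0 by rewrite mulf_neq0 // expf_neq0.
have AE : A = A^`() * p.
  by rewrite /A expr2 !derivM mulrA -E; ring.
clearbody A.
have A'0 : A^`() != 0 by apply: contraNneq A0 => e; rewrite AE e mul0r.
(* [A = A' p] is differentiated twice with [A''' = 0]; eliminating [A''] leaves [A'] times the
   desired equation. *)
have E1 : A^`() = A^`()^`() * p + A^`() * p^`() by rewrite {1}AE derivM.
have E2 : A^`()^`() = A^`()^`() * p^`() + (A^`()^`() * p^`() + A^`() * p^`()^`()).
  by rewrite {1}E1 derivD !derivM deriv3 mul0r add0r.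
apply: (mulfI A'0); rewrite mulr1 /logpoly.
have e1 : A^`() * (1 - p^`()) = A^`()^`() * p by rewrite mulrBr mulr1 {1}E1; ring.
have e2 : A^`()^`() * (1 + p^`()) = A^`() * p^`()^`().
  by apply: subr0_eq; rewrite mulrDr mulr1 {1}E2; ring.
have -> : A^`() * (p * p^`()^`() + p^`() ^+ 2) =
   p * (A^`() * p^`()^`()) + A^`() * p^`() ^+ 2 by ring.
rewrite -e2 mulrA [p * _]mulrC -e1; ring.
Qed.

(** The [P_i] are the inverses of [f1], [f2], [f1 + f2] and [f1 - f2]. If [A] and [B] are [P1] and
    [P2] divided by their gcd, both [A + B] and [B - A] divide that gcd; the cofactor is constant,
    and comparing sizes gives degree 5 to all four factors. *)
Lemma logpoly_pair (P1 P2 P3 P4 : {poly k}) :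
  size P1 = 16%N -> size P2 = 16%N -> size P3 = 16%N -> size P4 = 16%N ->
  logpoly P1 -> logpoly P2 ->
  P3 * (P1 + P2) = P1 * P2 -> P4 * (P2 - P1) = P1 * P2 ->
  exists Q1 Q2 : {poly k},
    [/\ (size Q1 <= 6)%N, (size Q2 <= 6)%N & moore Q1`_5 Q2`_5 != 0] /\
    P1 = Q1 * (Q1 ^+ 2 - Q2 ^+ 2) /\ P2 = - Q2 * (Q1 ^+ 2 - Q2 ^+ 2).
Proof.
move=> s1 s2 s3 s4 L1 L2 E3 E4.
have nz (p : {poly k}) : size p = 16%N -> p != 0.
  by move=> s; rewrite -size_poly_gt0 s.
pose G := gcdp P1 P2; pose A := P1 %/ G; pose B := P2 %/ G.
have P1E : P1 = G * A by rewrite mulrC divpK ?dvdp_gcdl.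
have P2E : P2 = G * B by rewrite mulrC divpK ?dvdp_gcdr.
have G0 : G != 0 by apply: contraTneq (nz _ s1) => e; rewrite P1E e mul0r eqxx.
have A0 : A != 0 by apply: contraTneq (nz _ s1) => e; rewrite P1E e mulr0 eqxx.
have B0 : B != 0 by apply: contraTneq (nz _ s2) => e; rewrite P2E e mulr0 eqxx.
have /Bezout_eq1_coprimepP[[u v] /= uv] : coprimep A B.
  by apply: coprimep_div_gcd; rewrite nz.
clearbody G A B.
have {}E3 : P3 * (A + B) = G * (A * B).
  apply: (mulfI G0); rewrite [RHS](_ : _ = P1 * P2); last by rewrite P1E P2E; ring.
  by rewrite -E3 P1E P2E; ring.
have {}E4 : P4 * (B - A) = G * (A * B).
  apply: (mulfI G0); rewrite [RHS](_ : _ = P1 * P2); last by rewrite P1E P2E; ring.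
  by rewrite -E4 P1E P2E; ring.
have AB0 : G * (A * B) != 0 by rewrite !mulf_neq0.
have S0 : A + B != 0 by apply: contraNneq AB0 => e; rewrite -E3 e mulr0.
have D0 : B - A != 0 by apply: contraNneq AB0 => e; rewrite -E4 e mulr0.
(* [A + B] divides [G A B] and is coprime to [A B]. All Bezout pairs here come from [u A + v B = 1];
   the one for [A + B] and [B - A] also uses -2 = 1. *)
have dS : A + B %| G.
  rewrite -(@Gauss_dvdpl _ _ (A * B)) -?E3 ?dvdp_mull // coprimepMr.
  apply/andP; split; apply/Bezout_eq1_coprimepP.
    by exists (v, u - v); rewrite /= -uv; ring.
  by exists (u, v - u); rewrite /= -uv; ring.
have dD : B - A %| G.
  rewrite -(@Gauss_dvdpl _ _ (A * B)) -?E4 ?dvdp_mull // coprimepMr.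
  apply/andP; split; apply/Bezout_eq1_coprimepP.
    by exists (v, u + v); rewrite /= -uv; ring.
  by exists (- u, v + u); rewrite /= -uv; ring.
have : (A + B) * (B - A) %| G.
  rewrite Gauss_dvdp ?dS ?dD //; apply/Bezout_eq1_coprimepP.
  by exists (- u - v, u - v); rewrite /= -uv; ring.
move/divpK; move: (G %/ _) => H GE; rewrite -{}GE in P1E P2E E3 E4 G0 AB0.
have H0 : H != 0 by apply: contraNneq G0 => ->; rewrite mul0r.
have P3E : P3 = (B - A) * H * (A * B) by apply: (mulIf S0); rewrite E3; ring.
have P4E : P4 = (A + B) * H * (A * B) by apply: (mulIf D0); rewrite E4; ring.
(* At a root of [H] both [P1] and [P2] vanish, so [logpoly] makes both derivatives square to 1.
   Equating the squares kills [(A + B) (B - A)] or [H'] at that point, which is absurd. *)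
have /size_poly1P[h h0 HE] : size H == 1%N.
  apply/negPn/negP => /closed_rootP[a /rootP Ha].
  have ev (C : {poly k}) : logpoly (H * C) -> (C.[a] * H^`().[a]) ^+ 2 = 1.
    move/(congr1 (fun p => p.[a])); rewrite !derivM !hornerE Ha => <-; ring.
  have e1 := ev ((A + B) * (B - A) * A); have e2 := ev ((A + B) * (B - A) * B).
  have {}e1 : (((A + B) * (B - A) * A).[a] * H^`().[a]) ^+ 2 = 1.
    by apply: e1; rewrite /logpoly; move: L1; rewrite P1E /logpoly !mulrA.
  have {}e2 : (((A + B) * (B - A) * B).[a] * H^`().[a]) ^+ 2 = 1.
    by apply: e2; rewrite /logpoly; move: L2; rewrite P2E /logpoly !mulrA.
  rewrite !hornerE in e1 e2; move: A.[a] B.[a] H^`().[a] e1 e2 => s t g e1 e2.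
  have : ((s + t) * (t - s)) ^+ 3 * g ^+ 2 = 0.
    have /eqP := etrans e1 (esym e2); rewrite -subr_eq0 => /eqP e12.
    by apply: etrans (lincomb2 (-1) 0 e12 e12); ring.
  move/eqP; rewrite mulf_eq0 !expf_eq0 /= => /orP[]/eqP z; move: e1; rewrite z.
    by rewrite !mul0r expr0n => /eqP; rewrite eq_sym oner_eq0.
  by rewrite !mulr0 expr0n => /eqP; rewrite eq_sym oner_eq0.
(* A cube root of [- h] absorbs the constant together with the sign between [B^2 - A^2] and
   [A^2 - B^2]. *)
subst H; have [s sE] := closed_nth_root (- h) (isT : (0 < 3)%N).
have s0 : s != 0.
  by apply: contraNneq h0 => e; rewrite -oppr_eq0 -sE e expr0n.
have hE : h%:P = - s%:P ^+ 3 by rewrite -rmorphXn /= sE polyCN opprK.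
have sz (p q r : {poly k}) : p != 0 -> q != 0 -> r != 0 ->
   (size (h%:P * (p * q * r))%R = (size p + size q + size r).-2)%N.
  move=> p0 q0 r0; rewrite mul_polyC size_scale // !size_mul ?mulf_neq0 //.
  move: p0 q0 r0; rewrite -!size_poly_gt0.
  by move: (size p) (size q) (size r) => i j l; lia.
have z1 : ((size (A + B)%R + size (B - A)%R + size A).-2 = 16)%N.
  by rewrite -sz // -s1 P1E; congr (size (polyseq _)); ring.
have z2 : ((size (A + B)%R + size (B - A)%R + size B).-2 = 16)%N.
  by rewrite -sz // -s2 P2E; congr (size (polyseq _)); ring.
have z3 : ((size (B - A)%R + size A + size B).-2 = 16)%N.
  by rewrite -sz // -s3 P3E; congr (size (polyseq _)); ring.
have z4 : ((size (A + B)%R + size A + size B).-2 = 16)%N.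
  by rewrite -sz // -s4 P4E; congr (size (polyseq _)); ring.
have [sA sB sS sD] : [/\ size A = 6%N, size B = 6%N, size (A + B)%R = 6%N &
    size (B - A)%R = 6%N].
  exact: degrees_eq5 z1 z2 z3 z4.
have top (p : {poly k}) : size p = 6%N -> p`_5 != 0.
  by move=> e; rewrite -[5%N]/(6.-1) -e -lead_coefE lead_coef_eq0 -size_poly_gt0 e.
exists (s *: A), (- s *: B); split; [split|split].
- by rewrite size_scale ?sA.
- by rewrite size_scale ?oppr_eq0 ?sB.
- rewrite !coefZ /moore.
  have -> : (s * A`_5) ^+ 3 * (- s * B`_5) - s * A`_5 * (- s * B`_5) ^+ 3 =
     s ^+ 4 * (A`_5 * B`_5 * ((A`_5 + B`_5) * (B`_5 - A`_5))) by ring.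
  by rewrite -coefD -coefB !mulf_neq0 ?expf_neq0 ?top.
- by rewrite P1E hE -!mul_polyC polyCN; ring.
- by rewrite P2E hE -!mul_polyC polyCN; ring.
Qed.

(** For [P = Q1 (Q1^2 - Q2^2)], characteristic 3 gives [P' = - Q2 W], hence [P P' = - W M]; and
    [logpoly P] says [(P P')' = 1]. *)
Lemma logpoly_wronskian_moore (Q1 Q2 : {poly k}) :
  logpoly (Q1 * (Q1 ^+ 2 - Q2 ^+ 2)) -> (wronskian Q1 Q2 * moore Q1 Q2)^`() = -1.
Proof.
by move=> <-; rewrite /wronskian /moore !(exprS, expr0, mulr1) !derivE; ring.
Qed.

End Forms.

(** * Change of basis and affine pullback for the spaces Omega(Q1, Q2) *)

Section Spaces.
Variable k : closedFieldType.
Implicit Types (p q : {poly k}) (z : k).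
Hypothesis h3 : 3 = 0 :> k.
Let h3P : 3 = 0 :> {poly k}. Proof. by rewrite -[3]polyC_natr h3. Qed.

Lemma frac_eqP p q p' q' : q != 0 -> q' != 0 ->
  (p%:F / q%:F = p'%:F / q'%:F :> ratfun k) <-> p * q' = p' * q.
Proof.
move=> q0 q'0; split=> [/eqP|e].
  by rewrite eqr_div ?tofrac_eq0 // -!tofracM tofrac_eq => /eqP.
by apply/eqP; rewrite eqr_div ?tofrac_eq0 // -!tofracM tofrac_eq e.
Qed.

(* The prime field F_3 is encoded inside [k] by the equation [z ^+ 3 = z]. *)
Lemma cube_idP z : z ^+ 3 = z -> [\/ z = 0, z = 1 | z = -1].
Proof.
move=> e; have : z * ((z - 1) * (z + 1)) = z ^+ 3 - z by ring.
rewrite e subrr.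
move/eqP; rewrite !mulf_eq0 subr_eq0 addr_eq0.
by case/or3P => /eqP ->; [constructor 1|constructor 2|constructor 3].
Qed.

Lemma cube_id_natr (c : 'F_3) : (c%:R : k) ^+ 3 = c%:R.
Proof.
case: c => [[|[|[|n]]] hn] //=; rewrite ?expr0n ?expr1n //.
by apply: subr0_eq; ring.
Qed.

Lemma F3comb2 (w : 2.-tuple (ratfun k)) c :
  F3comb w c = tnth w ord0 *+ c ord0 + tnth w (lift ord0 ord0) *+ c (lift ord0 ord0).
Proof. by rewrite /F3comb !big_ord_recl big_ord0 addr0. Qed.

Lemma cube_id_F3 z : z ^+ 3 = z -> exists c : 'F_3, z = c%:R.
Proof.
case/cube_idP => ->; [exists 0|exists 1|exists 2%:R] => //.
by rewrite (_ : nat_of_ord _ = 2%N) //; ring.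
Qed.

Lemma OmegaQP (Q1 Q2 : {poly k}) f : OmegaQ Q1 Q2 f <->
  exists z1 z2, [/\ z1 ^+ 3 = z1, z2 ^+ 3 = z2 &
    f = (z1 *: Q2 - z2 *: Q1)%:F / (moore Q1 Q2)%:F].
Proof.
have comb (c d : 'F_3) : Q2%:F / (moore Q1 Q2)%:F *+ c + (- Q1)%:F / (moore Q1 Q2)%:F *+ d
    = (c%:R *: Q2 - d%:R *: Q1)%:F / (moore Q1 Q2)%:F.
  rewrite -!mulrnAl -mulrDl -!rmorphMn -rmorphD /=; congr (_%:F / _).
  by rewrite !scaler_nat mulNrn.
split=> [[c _ <-]|[z1 [z2 [/cube_id_F3[c ->] /cube_id_F3[d ->] ->]]]].
  exists (c ord0)%:R, (c (lift ord0 ord0))%:R; split; try exact: cube_id_natr.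
  by rewrite F3comb2 -comb.
exists [ffun i => if i == ord0 then c else d] => //.
by rewrite F3comb2 !ffunE /= -comb.
Qed.

Lemma mooreZ (R : comPzRingType) (s x y : R) :
  moore (s * x) (s * y) = s ^+ 4 * moore x y.
Proof. by rewrite /moore; ring. Qed.

Lemma cube_idD z1 z2 : z1 ^+ 3 = z1 -> z2 ^+ 3 = z2 -> (z1 + z2) ^+ 3 = z1 + z2.
Proof. by move=> e1 e2; rewrite -{2}e1 -{2}e2; ring. Qed.

Lemma cube_idM z1 z2 : z1 ^+ 3 = z1 -> z2 ^+ 3 = z2 -> (z1 * z2) ^+ 3 = z1 * z2.
Proof. by move=> e1 e2; rewrite exprMn e1 e2. Qed.

Lemma cube_idN z : z ^+ 3 = z -> (- z) ^+ 3 = - z.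
Proof. by move=> e; rewrite -{2}e; ring. Qed.

(** [moore] is the determinant with rows [(x^3, x)] and [(y^3, y)], and cubing is F_3-linear, so a
    change of basis multiplies it by the determinant of the matrix. *)
Lemma moore_lin (R : comPzRingType) (r3 : 3 = 0 :> R) (a b c d x y : R) :
  a ^+ 3 = a -> b ^+ 3 = b -> c ^+ 3 = c -> d ^+ 3 = d ->
  moore (a * x + b * y) (c * x + d * y) = (a * d - b * c) * moore x y.
Proof.
move=> ea eb ec ed; rewrite /moore.
have -> : (a * x + b * y) ^+ 3 = a ^+ 3 * x ^+ 3 + b ^+ 3 * y ^+ 3 by ring.
have -> : (c * x + d * y) ^+ 3 = c ^+ 3 * x ^+ 3 + d ^+ 3 * y ^+ 3 by ring.
by rewrite ea eb ec ed; ring.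
Qed.

Lemma moore_linZ a b c d p q :
  a ^+ 3 = a -> b ^+ 3 = b -> c ^+ 3 = c -> d ^+ 3 = d ->
  moore (a *: p + b *: q) (c *: p + d *: q) = (a * d - b * c) *: moore p q.
Proof.
move=> ea eb ec ed; rewrite -!mul_polyC moore_lin //; last 4 first.
- by rewrite -rmorphXn /= ea.
- by rewrite -rmorphXn /= eb.
- by rewrite -rmorphXn /= ec.
- by rewrite -rmorphXn /= ed.
by rewrite rmorphB !rmorphM.
Qed.

Lemma OmegaQ_GL2 (R1 R2 : {poly k}) (a b c d : k) :
  a ^+ 3 = a -> b ^+ 3 = b -> c ^+ 3 = c -> d ^+ 3 = d ->
  a * d - b * c != 0 -> moore R1 R2 != 0 ->
  OmegaQ (a *: R1 + b *: R2) (c *: R1 + d *: R2) = OmegaQ R1 R2.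
Proof.
move=> ea eb ec ed D0 M0.
have De : (a * d - b * c) ^+ 3 = a * d - b * c.
  by rewrite cube_idD ?cube_idN ?cube_idM.
(* A nonzero element of F_3 is its own inverse, so the inverse matrix used below is the determinant
   times the adjugate. *)
have D2 : (a * d - b * c) * (a * d - b * c) = 1.
  by apply: (mulfI D0); rewrite mulr1 -[RHS]De; ring.
have DM0 : (a * d - b * c) *: moore R1 R2 != 0 by rewrite scaler_eq0 negb_or D0.
apply/seteqP; split=> f /OmegaQP[t1 [t2 [e1 e2 ->]]]; apply/OmegaQP.
  rewrite moore_linZ //.
  exists ((a * d - b * c) * (t1 * d - t2 * b)), ((a * d - b * c) * (t2 * a - t1 * c)).
  split; try by rewrite cube_idM // cube_idD ?cube_idN ?cube_idM.
  apply/frac_eqP => //; rewrite -!mul_polyC.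
  have D2P : (a * d - b * c)%:P * (a * d - b * c)%:P = 1 by rewrite -polyCM D2.
  rewrite 2!(polyCM (a * d - b * c)).
  rewrite -[LHS]mul1r -D2P.
  by move: (a * d - b * c)%:P => D; rewrite !(polyCB, polyCM); ring.
exists (a * t1 + b * t2), (c * t1 + d * t2).
split; try by rewrite cube_idD ?cube_idM.
by rewrite moore_linZ //; apply/frac_eqP => //; rewrite -!mul_polyC; ring.
Qed.

Lemma moore_comp p q r : moore (p \Po r) (q \Po r) = moore p q \Po r.
Proof. by rewrite /moore comp_polyB !comp_polyM. Qed.

Lemma affine_size (alpha beta : k) : alpha != 0 ->
  size (alpha *: 'X + beta%:P) = 2%N.
Proof.
move=> a0; rewrite size_polyDl ?size_scale ?size_polyX //.
by rewrite (leq_ltn_trans (size_polyC_leq1 _)).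
Qed.

Lemma comp_affine_neq0 p (alpha beta : k) : alpha != 0 -> p != 0 ->
  p \Po (alpha *: 'X + beta%:P) != 0.
Proof.
by move=> a0; rewrite -!size_poly_gt0 size_comp_poly2 // affine_size.
Qed.

Lemma peval_tofrac p q : peval p q%:F = (p \Po q)%:F.
Proof.
rewrite /peval /map_poly horner_poly comp_polyE rmorph_sum /=.
by apply: eq_bigr => i _; rewrite -mul_polyC tofracM tofracXn.
Qed.

Lemma pullback_affine p q (alpha beta : k) : alpha != 0 -> q != 0 ->
  let s := alpha *: 'X + beta%:P in
  pullback s%:F (p%:F / q%:F) = (alpha *: (p \Po s))%:F / (q \Po s)%:F.
Proof.
move=> a0 q0 s; rewrite /pullback fcomp_frac //; last first.
  by move=> r r0; rewrite peval_tofrac tofrac_eq0 comp_affine_neq0.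
have -> : fderiv s%:F = alpha%:P%:F.
  rewrite -[s%:F]divr1 -tofrac1 fderiv_frac ?oner_neq0 // expr1n tofrac1 divr1.
  congr (_%:F); rewrite derivC mulr0 subr0 mulr1 /s derivD derivC addr0 derivZ derivX.
  by rewrite alg_polyC.
by rewrite !peval_tofrac -mul_polyC tofracM mulrAC [_ * alpha%:P%:F]mulrC.
Qed.

(** Scaling both polynomials by [s] multiplies the forms by [s / s^4], which equals the factor
    [alpha] produced by the differential of [sg]. *)
Lemma OmegaQ_pullback (Q1 Q2 : {poly k}) (alpha beta s : k) :
  alpha != 0 -> s ^+ 3 * alpha = 1 -> moore Q1 Q2 != 0 ->
  let sg := alpha *: 'X + beta%:P in
  OmegaQ (s *: (Q1 \Po sg)) (s *: (Q2 \Po sg)) =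
  (pullback sg%:F @` OmegaQ Q1 Q2)%classic.
Proof.
move=> a0 sa M0 sg.
have Ms0 : moore (Q1 \Po sg) (Q2 \Po sg) != 0.
  by rewrite moore_comp comp_affine_neq0.
have s0 : s != 0.
  apply/eqP => e; move/eqP: sa; rewrite e expr0n mul0r.
  by rewrite eq_sym oner_eq0.
have MZ : moore (s *: (Q1 \Po sg)) (s *: (Q2 \Po sg)) != 0.
  by rewrite -!mul_polyC mooreZ mulf_neq0 // expf_neq0 // polyC_eq0.
have key z1 z2 : pullback sg%:F ((z1 *: Q2 - z2 *: Q1)%:F / (moore Q1 Q2)%:F) =
   (z1 *: (s *: (Q2 \Po sg)) - z2 *: (s *: (Q1 \Po sg)))%:F /
   (moore (s *: (Q1 \Po sg)) (s *: (Q2 \Po sg)))%:F.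
  rewrite pullback_affine // -/sg comp_polyB !comp_polyZ -moore_comp.
  apply/frac_eqP => //; rewrite -!mul_polyC mooreZ.
  have saP : s%:P ^+ 3 * alpha%:P = 1 by rewrite -rmorphXn -polyCM sa.
  by rewrite -[RHS]mul1r -saP; ring.
apply/seteqP; split=> f.
  move=> /OmegaQP[z1 [z2 [e1 e2 ->]]].
  by exists ((z1 *: Q2 - z2 *: Q1)%:F / (moore Q1 Q2)%:F); [apply/OmegaQP; exists z1, z2|].
move=> [g /OmegaQP[z1 [z2 [e1 e2 ->]]] <-]; apply/OmegaQP.
by exists z1, z2; split.
Qed.

End Spaces.

(** * Models with the same parameter P are equivalent *)

Section Models.
Variable k : closedFieldType.
Implicit Types (p : {poly k}) (z q y P a b : k).
Hypothesis h3 : 3 = 0 :> k.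
Let h3P : 3 = 0 :> {poly k}. Proof. by rewrite -[3]polyC_natr h3. Qed.

Lemma model_poly_lin q y P (z1 z2 a b : k) : z1 ^+ 3 = z1 -> z2 ^+ 3 = z2 ->
  model_poly q y P (z1 * a + z2 * b) =
  z1 *: model_poly q y P a + z2 *: model_poly q y P b.
Proof.
move=> e1 e2.
have e : (z1 * a + z2 * b) ^+ 3 = z1 * a ^+ 3 + z2 * b ^+ 3.
  by rewrite -{2}e1 -{2}e2; ring.
rewrite /model_poly e -!mul_polyC; ring.
Qed.

(* Cramer's rule: the coordinates of a third root of an additive polynomial of
   degree 9 in a basis of roots are fixed by the Frobenius. *)
Lemma model_root_lin q y P a b x : y != 0 -> moore a b != 0 ->
  model_root q y P a -> model_root q y P b -> model_root q y P x ->
  exists z1 z2, [/\ z1 ^+ 3 = z1, z2 ^+ 3 = z2 & x = z1 * a + z2 * b].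
Proof.
rewrite /model_root /=; move: (_ * q ^+ 6 * y) (P * model_u P * q ^+ 8) => c d.
move=> y0 m0 ea eb ex; pose m := moore a b.
pose z1 := (x ^+ 3 * b - x * b ^+ 3) / m; pose z2 := (a ^+ 3 * x - a * x ^+ 3) / m.
have z1m : z1 * m = x ^+ 3 * b - x * b ^+ 3 by rewrite divfK.
have z2m : z2 * m = a ^+ 3 * x - a * x ^+ 3 by rewrite divfK.
have xE : x = z1 * a + z2 * b.
  apply: (mulIf (m0 : m != 0)); rewrite mulrDl.
  by rewrite [z1 * _ * m]mulrAC z1m [z2 * _ * m]mulrAC z2m /m /moore; ring.
have x3E : x ^+ 3 = z1 * a ^+ 3 + z2 * b ^+ 3.
  apply: (mulIf (m0 : m != 0)); rewrite mulrDl.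
  by rewrite [z1 * _ * m]mulrAC z1m [z2 * _ * m]mulrAC z2m /m /moore; ring.
have x9E : x ^+ 9 = z1 * a ^+ 9 + z2 * b ^+ 9.
  apply: (mulfI (expf_neq0 4 y0)).
  have -> : y ^+ 4 * (z1 * a ^+ 9 + z2 * b ^+ 9) =
    z1 * (y ^+ 4 * a ^+ 9) + z2 * (y ^+ 4 * b ^+ 9) by ring.
  by rewrite ex ea eb x3E {1}xE; ring.
have f3 : (z1 ^+ 3 - z1) * a ^+ 3 + (z2 ^+ 3 - z2) * b ^+ 3 = 0.
  by rewrite -[RHS](subrr (x ^+ 3)) {1}xE x3E; ring.
have f9 : (z1 ^+ 3 - z1) * a ^+ 9 + (z2 ^+ 3 - z2) * b ^+ 9 = 0.
  rewrite -[RHS](subrr (x ^+ 9)) {2}x9E.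
  have -> : x ^+ 9 = (x ^+ 3) ^+ 3 by ring.
  by rewrite x3E; ring.
have m3 : moore a b ^+ 3 != 0 by rewrite expf_neq0.
exists z1, z2; split=> //; apply: subr0_eq; apply: (mulIf m3); rewrite mul0r.
  apply: etrans (lincomb2 (- b ^+ 9) (b ^+ 3) f3 f9); rewrite /moore; ring.
apply: etrans (lincomb2 (a ^+ 9) (- a ^+ 3) f3 f9); rewrite /moore; ring.
Qed.

(** Weighted homogeneity, with [q] of weight 1 and [P] of weight 0. The factor on [y] is the one for
    which [s * a ^+ 3 * (s ^+ 2 * alpha ^+ 12 * y) * alpha ^+ 3] is [y] times the cube of the new
    leading coefficient. *)
Lemma model_poly_scale q y P a (alpha s : k) :
  s *: (model_poly (alpha * q) (s ^+ 2 * alpha ^+ 12 * y) P a \Po (alpha *: 'X)) =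
  model_poly q y P (s * alpha ^+ 5 * a).
Proof.
rewrite /model_poly !(comp_polyD, comp_polyZ, comp_Xn_poly, comp_polyX, comp_polyC).
by rewrite -!mul_polyC; ring.
Qed.

Lemma model_root_scale q y P a (alpha s : k) : s != 0 -> alpha != 0 ->
  model_root (alpha * q) (s ^+ 2 * alpha ^+ 12 * y) P a ->
  model_root q y P (s * alpha ^+ 5 * a).
Proof.
move=> s0 al0; rewrite /model_root /= => e.
apply: (mulfI (expf_neq0 3 al0)).
apply: (@etrans _ _ (s * ((s ^+ 2 * alpha ^+ 12 * y) ^+ 4 * a ^+ 9))).
  by ring.
by rewrite e; ring.
Qed.

(** [moore] splits as [x y (x - y) (x + y)]: if it vanishes on the polynomials, one of these four
    factors is zero, and so is the same factor on coefficients. *)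
Lemma moore_neq0_coef p1 p2 n : moore p1`_n p2`_n != 0 -> moore p1 p2 != 0.
Proof.
have fac (R : comPzRingType) (x y : R) : moore x y = x * y * ((x - y) * (x + y)).
  by rewrite /moore; ring.
apply: contra_neq; rewrite !fac -coefB -coefD => /eqP.
by rewrite !mulf_eq0 => /orP[]/orP[]/eqP ->; rewrite coef0 !(mul0r, mulr0).
Qed.

Lemma coef5_model_poly q y P a : (model_poly q y P a)`_5 = a.
Proof.
rewrite /model_poly !(coefD, coefZ, coefXn, coefX, coefC) /=.
by rewrite !(mulr0, mulr1, addr0).
Qed.

(** The dilation [q / q'] aligns [q], and a scalar [s] aligns [y]. The two equations for [y ^+ 3]
    give [(s ^+ 3 * al) ^+ 2 = 1], and the sign of [s] is free. Both pairs of leading coefficients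
    are then bases of the roots of one additive polynomial, so they differ by a matrix in
    GL_2(F_3). *)
Lemma model_equiv (Q1 Q2 : {poly k}) (z q y q' y' P a b a' b' : k) :
  model q y P a b -> model q' y' P a' b' ->
  Q1 \Po ('X + z%:P) = model_poly q y P a ->
  Q2 \Po ('X + z%:P) = model_poly q y P b ->
  moore Q1 Q2 != 0 ->
  space_equiv (OmegaQ Q1 Q2)
              (OmegaQ (model_poly q' y' P a') (model_poly q' y' P b')).
Proof.
move=> [QP q0 y0 yE [m0 ra rb]] [_ q'0 y'0 y'E [m'0 ra' rb']] Q1E Q2E M0.
pose al := q / q'.
have al0 : al != 0 by rewrite mulf_neq0 ?invr_eq0.
have qE : q = al * q' by rewrite divfK.
have [s [s0 sy sal]] : exists s, [/\ s != 0, y = s ^+ 2 * al ^+ 12 * y' & s ^+ 3 * al = 1].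
  have [s sE] := closed_nth_root (y / y' / al ^+ 12) (isT : (0 < 2)%N).
  have yE' : y = s ^+ 2 * al ^+ 12 * y' by rewrite sE divfK ?expf_neq0 // divfK.
  have s0 : s != 0 by apply: contra_neq y0 => e; rewrite yE' e expr0n !mul0r.
  have s6 : (s ^+ 3 * al - 1) * (s ^+ 3 * al + 1) = 0.
    have nz : al ^+ 34 * y' ^+ 3 != 0 by rewrite mulf_neq0 ?expf_neq0.
    apply: (mulIf nz); rewrite mul0r.
    apply: etrans (_ : y ^+ 3 - al ^+ 34 * y' ^+ 3 = _); first by rewrite yE'; ring.
    by rewrite yE y'E qE; ring.
  move/eqP: s6; rewrite mulf_eq0 subr_eq0 addr_eq0 => /orP[]/eqP e.
    by exists s.
  exists (- s); rewrite oppr_eq0 s0 sqrrN; split=> //.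
  by rewrite -[RHS]opprK -e; ring.
clearbody al; subst q y.
have m1 : moore (s * al ^+ 5 * a) (s * al ^+ 5 * b) != 0.
  by rewrite mooreZ mulf_neq0 // expf_neq0 // mulf_neq0 // expf_neq0.
have r1 := model_root_scale s0 al0 ra; have r2 := model_root_scale s0 al0 rb.
have [z11 [z12 [e11 e12 aE]]] := model_root_lin y'0 m1 r1 r2 ra'.
have [z21 [z22 [e21 e22 bE]]] := model_root_lin y'0 m1 r1 r2 rb'.
have D0 : z11 * z22 - z12 * z21 != 0.
  apply: contra_neq m'0 => e.
  by rewrite aE bE moore_lin // e mul0r.
pose sg : {poly k} := al *: 'X + z%:P.
have sgE (p : {poly k}) : (p \Po ('X + z%:P)) \Po (al *: 'X) = p \Po sg.
  by rewrite -comp_polyA comp_polyD comp_polyX comp_polyC.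
have R1E : s *: (Q1 \Po sg) = model_poly q' y' P (s * al ^+ 5 * a).
  by rewrite -sgE Q1E model_poly_scale.
have R2E : s *: (Q2 \Po sg) = model_poly q' y' P (s * al ^+ 5 * b).
  by rewrite -sgE Q2E model_poly_scale.
exists al, z; split=> //; rewrite -(OmegaQ_pullback h3 z al0 sal M0).
rewrite aE bE !model_poly_lin // -R1E -R2E OmegaQ_GL2 // R1E R2E.
by apply: (@moore_neq0_coef _ _ 5); rewrite !coef5_model_poly.
Qed.

End Models.

(** * Recovering P from the equivalence class *)

Section Distinct.
Variable k : closedFieldType.
Implicit Types (p : {poly k}) (z q y P a b : k).
Hypothesis h3 : 3 = 0 :> k.
Let h3P : 3 = 0 :> {poly k}. Proof. by rewrite -[3]polyC_natr h3. Qed.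

Lemma size_model_poly q y P a : (size (model_poly q y P a) <= 6)%N.
Proof.
apply/leq_sizeP => j; case: j => [|[|[|[|[|[|j]]]]]] // _.
rewrite /model_poly !(coefD, coefZ, coefXn, coefX, coefC) /=.
by rewrite !(mulr0, addr0).
Qed.

Lemma coefs_model_poly q y P a :
  [/\ (model_poly q y P a)`_4 = 0,
      (model_poly q y P a)`_3 = a * (P * q ^+ 2) + a ^+ 3 * y
    & (model_poly q y P a)`_2 = a * (model_u P * q ^+ 3) + a ^+ 3 * (y * q)].
Proof.
rewrite /model_poly; split; rewrite !(coefD, coefZ, coefXn, coefX, coefC) /=;
by rewrite !(mulr0, mulr1, addr0, add0r) ?mulrA.
Qed.

Lemma coefs_comp_affine p (al be : k) : (size p <= 6)%N ->
  [/\ (p \Po (al *: 'X + be%:P))`_5 = al ^+ 5 * p`_5,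
      (p \Po (al *: 'X + be%:P))`_4 = al ^+ 4 * (p`_4 - be * p`_5),
      be = 0 -> (p \Po (al *: 'X + be%:P))`_3 = al ^+ 3 * p`_3
    & be = 0 -> (p \Po (al *: 'X + be%:P))`_2 = al ^+ 2 * p`_2].
Proof.
move=> sp; have -> : al *: 'X + be%:P = ('X + be%:P) \Po (al *: 'X).
  by rewrite comp_polyD comp_polyX comp_polyC.
have e (c5 c4 c3 c2 c1 c0 : k) :
    (c5 *: 'X^5 + c4 *: 'X^4 + c3 *: 'X^3 + c2 *: 'X^2 + c1 *: 'X + c0%:P)
      \Po (al *: 'X) =
    (al ^+ 5 * c5) *: 'X^5 + (al ^+ 4 * c4) *: 'X^4 + (al ^+ 3 * c3) *: 'X^3
     + (al ^+ 2 * c2) *: 'X^2 + (al * c1) *: 'X + c0%:P.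
  rewrite !(comp_polyD, comp_polyZ, comp_Xn_poly, comp_polyX, comp_polyC).
  by rewrite -!mul_polyC; ring.
rewrite comp_polyA; split.
- have [c2 [c1 [c0 ->]]] := comp_shift6 h3 be sp; rewrite e.
  rewrite !(coefD, coefZ, coefXn, coefX, coefC) /=.
  by rewrite !(mulr0, mulr1, addr0, add0r).
- have [c2 [c1 [c0 ->]]] := comp_shift6 h3 be sp; rewrite e.
  rewrite !(coefD, coefZ, coefXn, coefX, coefC) /=.
  by rewrite !(mulr0, mulr1, addr0, add0r).
- move=> ->; rewrite addr0 comp_polyXr {1}(poly_sum6 sp) e.
  rewrite !(coefD, coefZ, coefXn, coefX, coefC) /=.
  by rewrite !(mulr0, mulr1, addr0, add0r).
- move=> ->; rewrite addr0 comp_polyXr {1}(poly_sum6 sp) e.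
  rewrite !(coefD, coefZ, coefXn, coefX, coefC) /=.
  by rewrite !(mulr0, mulr1, addr0, add0r).
Qed.

(** Separates an identity between coefficients of models into the part linear in the leading
    coefficient and the part in its cube. *)
Lemma moore_indep (l1 l2 A B : k) : moore l1 l2 != 0 ->
  l1 * A + l1 ^+ 3 * B = 0 -> l2 * A + l2 ^+ 3 * B = 0 -> A = 0 /\ B = 0.
Proof.
move=> m0 e1 e2; split; apply: (mulfI m0); rewrite mulr0 /moore.
  by apply: etrans (lincomb2 (- l2 ^+ 3) (l1 ^+ 3) e1 e2); ring.
by apply: etrans (lincomb2 l2 (- l1) e1 e2); ring.
Qed.

(* The cube of the ratio of the two Moore determinants is constant, hence so is
   the ratio. *)
Lemma OmegaQ_pullback_inv (Q1 Q2 Q1' Q2' : {poly k}) (al be : k) :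
  let sg := al *: 'X + be%:P in
  al != 0 -> moore Q1 Q2 != 0 -> moore Q1' Q2' != 0 ->
  OmegaQ Q1' Q2' = (pullback sg%:F @` OmegaQ Q1 Q2)%classic ->
  exists s z11 z12 z21 z22,
    [/\ s != 0, z11 ^+ 3 = z11 /\ z12 ^+ 3 = z12, z21 ^+ 3 = z21 /\ z22 ^+ 3 = z22,
        Q1' = s *: (z11 *: (Q1 \Po sg) + z12 *: (Q2 \Po sg))
      & Q2' = s *: (z21 *: (Q1 \Po sg) + z22 *: (Q2 \Po sg))].
Proof.
move=> sg al0 M0 M'0 E.
have Ms0 : moore (Q1 \Po sg) (Q2 \Po sg) != 0.
  by rewrite moore_comp comp_affine_neq0.
have mem w1 w2 : w1 ^+ 3 = w1 -> w2 ^+ 3 = w2 -> exists t1 t2,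
    [/\ t1 ^+ 3 = t1, t2 ^+ 3 = t2 &
     al%:P * (t1 *: (Q1 \Po sg) + t2 *: (Q2 \Po sg)) * moore Q1' Q2' =
     (w1 *: Q2' - w2 *: Q1') * moore (Q1 \Po sg) (Q2 \Po sg)].
  move=> e1 e2.
  have : OmegaQ Q1' Q2' ((w1 *: Q2' - w2 *: Q1')%:F / (moore Q1' Q2')%:F).
    by apply/OmegaQP => //; exists w1, w2.
  rewrite E => -[g /OmegaQP[//|t1 [t2 [f1 f2 ->]]]].
  rewrite pullback_affine // -/sg -moore_comp.
  move/(proj1 (frac_eqP _ _ Ms0 M'0)) => e.
  exists (- t2), t1; rewrite f1 cube_idN //; split=> //.
  by rewrite -e comp_polyB !comp_polyZ mul_polyC scaleNr addrC.
have o3 : 1 ^+ 3 = 1 :> k by rewrite expr1n.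
have z3 : 0 ^+ 3 = 0 :> k by rewrite expr0n.
have [z21 [z22 [e21 e22]]] := mem 1 0 o3 z3.
have [z11 [z12 [e11 e12]]] := mem 0 (-1) z3 (cube_idN h3 o3).
rewrite !(scale0r, scale1r, scaleN1r, subr0, opprK, sub0r, add0r) => c1 c2.
set N1 := z11 *: _ + _ in c1 *; set N2 := z21 *: _ + _ in c2 *.
set M := moore (Q1 \Po sg) _ in c1 c2 Ms0; set M' := moore Q1' _ in c1 c2 M'0.
pose D := z11 * z22 - z12 * z21.
have NE : moore N1 N2 = D *: M by rewrite moore_linZ.
(* Applying [moore] to the two relations [al N_i M' = Q_i' M] gives [al^4 D M M'^4 = M^4 M']. *)
have M3 : M ^+ 3 = (al ^+ 4 * D) *: M' ^+ 3.
  have nz : M * M' != 0 by rewrite mulf_neq0.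
  apply: (mulfI nz).
  apply: (@etrans _ _ (moore (M * Q1') (M * Q2'))).
    by rewrite mooreZ -/M'; ring.
  rewrite ![M * _]mulrC -c1 -c2 ![al%:P * _ * M']mulrAC.
  by rewrite mooreZ NE -!mul_polyC; ring.
have [t tE] := closed_nth_root (al ^+ 4 * D) (isT : (0 < 3)%N).
have Mt : M = t *: M'.
  have /eqP : (M - t *: M') ^+ 3 = 0 by rewrite cubeB // M3 exprZn tE subrr.
  by rewrite expf_eq0 /= subr_eq0 => /eqP.
have t0 : t != 0 by apply: contraNneq Ms0 => e; rewrite Mt e scale0r.
exists (al / t), z11, z12, z21, z22; split=> //.
- by rewrite mulf_neq0 ?invr_eq0.
- apply: (scalerI t0); rewrite scalerA mulrC divfK // -/N1 -mul_polyC.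
  by apply: (mulIf M'0); rewrite -[al *: N1]mul_polyC c1 Mt -!mul_polyC; ring.
- apply: (scalerI t0); rewrite scalerA mulrC divfK // -/N2 -mul_polyC.
  by apply: (mulIf M'0); rewrite -[al *: N2]mul_polyC c2 Mt -!mul_polyC; ring.
Qed.

(** Both models lack a term of degree 4, so the affine map is a dilation. Its effect on [y] in
    degree 3 and on [y * q] in degree 2 gives [q = al * q']; the linear part in degree 3 then gives
    [P' = P]. *)
Lemma model_equiv_param q y P a b q' y' P' a' b' :
  model q y P a b -> model q' y' P' a' b' ->
  space_equiv (OmegaQ (model_poly q y P a) (model_poly q y P b))
              (OmegaQ (model_poly q' y' P' a') (model_poly q' y' P' b')) ->
  P' = P.
Proof.
move=> [_ q0 y0 _ [m0 _ _]] [_ q'0 y'0 _ [m'0 _ _]] [al [be [al0 E]]].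
have mnz q1 y1 P1 a1 b1 : moore a1 b1 != 0 ->
    moore (model_poly q1 y1 P1 a1) (model_poly q1 y1 P1 b1) != 0.
  by move=> e; apply: (@moore_neq0_coef _ _ _ 5); rewrite !coef5_model_poly.
have [s [z11 [z12 [z21 [z22 [s0 [e11 e12] [e21 e22] Q1E Q2E]]]]]] :=
  OmegaQ_pullback_inv al0 (mnz _ _ _ _ _ m0) (mnz _ _ _ _ _ m'0) E.
have [A5 A4 A3 A2] := coefs_comp_affine al be (size_model_poly q y P a).
have [B5 B4 B3 B2] := coefs_comp_affine al be (size_model_poly q y P b).
have [a4 a3 a2] := coefs_model_poly q y P a.
have [b4 b3 b2] := coefs_model_poly q y P b.
have [a'4 a'3 a'2] := coefs_model_poly q' y' P' a'.
have [b'4 b'3 b'2] := coefs_model_poly q' y' P' b'.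
pose l1 := z11 * a + z12 * b; pose l2 := z21 * a + z22 * b.
have Cn (p1 p2 p3 : {poly k}) c c1 c2 n : p1 = c *: (c1 *: p2 + c2 *: p3) ->
    p1`_n = c * (c1 * p2`_n + c2 * p3`_n).
  by move=> ->; rewrite coefZ coefD !coefZ.
have C1 n := Cn _ _ _ _ _ _ n Q1E; have C2 n := Cn _ _ _ _ _ _ n Q2E.
have a'E : a' = s * al ^+ 5 * l1.
  have := C1 5%N; rewrite A5 B5 !coef5_model_poly => ->.
  by rewrite /l1; ring.
have b'E : b' = s * al ^+ 5 * l2.
  have := C2 5%N; rewrite A5 B5 !coef5_model_poly => ->.
  by rewrite /l2; ring.
have ml : moore l1 l2 != 0.
  by apply: contra_neq m'0 => e; rewrite a'E b'E mooreZ e mulr0.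
have l10 : l1 != 0.
  by apply: contra_neq ml => ->; rewrite /moore expr0n !mul0r subr0.
have be0 : be = 0.
  have /esym/eqP := C1 4%N; rewrite A4 B4 a4 b4 a'4.
  rewrite !coef5_model_poly.
  have -> : s * (z11 * (al ^+ 4 * (0 - be * a)) + z12 * (al ^+ 4 * (0 - be * b)))
    = - s * al ^+ 4 * l1 * be by rewrite /l1; ring.
  have nz : - s * al ^+ 4 * l1 != 0 by rewrite !mulf_neq0 ?oppr_eq0 ?expf_neq0.
  by rewrite mulf_eq0 (negPf nz) => /eqP.
(* Each coefficient of a model has the shape [a A + a^3 B]; because cubing fixes [z1] and [z2],
   combinations regroup into the shape required by [moore_indep]. *)
have red z1 z2 x A' B' A B c : z1 ^+ 3 = z1 -> z2 ^+ 3 = z2 ->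
    x = s * al ^+ 5 * (z1 * a + z2 * b) ->
    x * A' + x ^+ 3 * B' =
      s * (z1 * (c * (a * A + a ^+ 3 * B)) + z2 * (c * (b * A + b ^+ 3 * B))) ->
    (z1 * a + z2 * b) * (s * al ^+ 5 * A' - s * c * A)
    + (z1 * a + z2 * b) ^+ 3 * ((s * al ^+ 5) ^+ 3 * B' - s * c * B) = 0.
  move=> e1 e2 -> /eqP; rewrite -subr_eq0 => /eqP e; rewrite -[RHS]e.
  have -> : (s * al ^+ 5 * (z1 * a + z2 * b)) ^+ 3 =
      (s * al ^+ 5) ^+ 3 * (z1 ^+ 3 * a ^+ 3 + z2 ^+ 3 * b ^+ 3) by ring.
  have -> : (z1 * a + z2 * b) ^+ 3 = z1 ^+ 3 * a ^+ 3 + z2 ^+ 3 * b ^+ 3 by ring.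
  by rewrite e1 e2; ring.
have [A3' B3'] : s * al ^+ 5 * (P' * q' ^+ 2) - s * al ^+ 3 * (P * q ^+ 2) = 0 /\
    (s * al ^+ 5) ^+ 3 * y' - s * al ^+ 3 * y = 0.
  apply: (moore_indep ml).
    apply: (red _ _ _ _ _ _ _ _ e11 e12 a'E).
    by have := C1 3; rewrite (A3 be0) (B3 be0) a3 b3 a'3.
  apply: (red _ _ _ _ _ _ _ _ e21 e22 b'E).
  by have := C2 3; rewrite (A3 be0) (B3 be0) a3 b3 b'3.
have [_ B2'] : s * al ^+ 5 * (model_u P' * q' ^+ 3) - s * al ^+ 2 * (model_u P * q ^+ 3) = 0 /\
    (s * al ^+ 5) ^+ 3 * (y' * q') - s * al ^+ 2 * (y * q) = 0.
  apply: (moore_indep ml).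
    apply: (red _ _ _ _ _ _ _ _ e11 e12 a'E).
    by have := C1 2; rewrite (A2 be0) (B2 be0) a2 b2 a'2.
  apply: (red _ _ _ _ _ _ _ _ e21 e22 b'E).
  by have := C2 2; rewrite (A2 be0) (B2 be0) a2 b2 b'2.
have qE : q = al * q'.
  have nz : s * al ^+ 2 * y != 0 by rewrite !mulf_neq0 ?expf_neq0.
  apply: (mulfI nz); apply: subr0_eq.
  by apply: etrans (lincomb2 (-1) q' B2' B3'); ring.
have nz : s * al ^+ 3 * q ^+ 2 != 0 by rewrite !mulf_neq0 ?expf_neq0.
apply: (mulfI nz); apply: subr0_eq.
by apply: etrans (lincomb2 1 0 A3' A3'); rewrite qE; ring.
Qed.

End Distinct.

(** * Reaching a pair of quintics from a space L_{15,2} *)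

Lemma inv_sum_cross (F : fieldType) (x y z : F) : x != 0 -> y != 0 -> z != 0 ->
  x^-1 + y^-1 = z^-1 -> z * (x + y) = x * y.
Proof.
move=> x0 y0 z0 e; have -> : x + y = x * y * (x^-1 + y^-1) by field; rewrite x0 y0.
by rewrite e mulrCA mulfV ?mulr1.
Qed.

Lemma inv_diff_cross (F : fieldType) (x y z : F) : x != 0 -> y != 0 -> z != 0 ->
  x^-1 - y^-1 = z^-1 -> z * (y - x) = x * y.
Proof.
move=> x0 y0 z0 e; have -> : y - x = x * y * (x^-1 - y^-1) by field; rewrite x0 y0.
by rewrite e mulrCA mulfV ?mulr1.
Qed.

Section Final.
Variable k : closedFieldType.
Implicit Types (p : {poly k}) (z q y P a b : k).
Hypothesis hk : 3%N \in [pchar k].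
Let h3 : 3 = 0 :> k. Proof. exact: pcharf0 hk. Qed.
Let h3P : 3 = 0 :> {poly k}. Proof. by rewrite -[3]polyC_natr h3. Qed.

Lemma Lspace_pair Omega : Lspace 14 2 Omega ->
  exists Q1 Q2 : {poly k},
    [/\ (size Q1 <= 6)%N, (size Q2 <= 6)%N & moore Q1`_5 Q2`_5 != 0] /\
    (wronskian Q1 Q2 * moore Q1 Q2)^`() = -1 /\ Omega = OmegaQ Q1 Q2.
Proof.
move=> [[w [wfree ->]] hO].
pose f1 := tnth w ord0; pose f2 := tnth w (lift ord0 ord0).
have wE : w = [tuple f1; f2].
  by apply: eq_from_tnth => -[[|[|//]] i2]; rewrite /f1 /f2; congr tnth; apply/val_inj.
have form (c d : 'F_3) : (c != 0) || (d != 0) -> exists p,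
    [/\ size p = 16%N, logpoly p & f1 *+ c + f2 *+ d = (p%:F)^-1].
  move=> cd; pose c' := [ffun i : 'I_2 => if i == ord0 then c else d].
  have cE : F3comb w c' = f1 *+ c + f2 *+ d by rewrite F3comb2 !ffunE.
  have nz : F3comb w c' != 0.
    apply/eqP => /wfree z; move: cd; have := z ord0; have := z (lift ord0 ord0).
    by rewrite !ffunE /= => -> ->; rewrite eqxx.
  have [lf li oa] := hO _ (ex_intro2 _ _ c' I erefl) nz.
  have [p p0 fE] := form_inv nz oa; exists p; split; last by rewrite -cE fE.
    (* Order 13 at infinity means degree 15, hence size 16. *)
    move: li; rewrite fE ford_inf_inv // => li.
    have : size p != 0%N by rewrite size_poly_eq0.
    by move: li; move: (size p) => n; clear; lia.
  by apply: logarithmic_inv; rewrite // -fE.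
(* One form on each of the four lines of the F_3-plane. *)
have [P1 [s1 l1]] := form 1 0 isT; have [P2 [s2 l2]] := form 0 1 isT.
have [P3 [s3 l3]] := form 1 1 isT; have [P4 [s4 l4]] := form 1 (-1) isT.
rewrite !mulr1n !mulr0n !(addr0, add0r) => E4 E3 f2E f1E.
have h3F : 3 = 0 :> ratfun k.
  by rewrite -(rmorph_nat (@FracField.tofrac {poly k})) h3P rmorph0.
(* The coefficient -1 of ['F_3] acts through its representative 2, and [f2 *+ 2 = - f2]. *)
have {}E4 : f1 - f2 = (P4%:F)^-1.
  rewrite -E4; congr (_ + _); rewrite (_ : nat_of_ord _ = 2%N) //.
  by apply/eqP; rewrite eq_sym -addr_eq0 -mulrSr -mulr_natr h3F mulr0.
have nz p : size p = 16%N -> p%:F != 0 :> ratfun k.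
  by move=> s; rewrite tofrac_eq0 -size_poly_gt0 s.
have c3 : P3 * (P1 + P2) = P1 * P2.
  apply/eqP; rewrite -tofrac_eq !tofracM tofracD; apply/eqP.
  apply: inv_sum_cross (nz _ s1) (nz _ s2) (nz _ s3) _.
  by rewrite -f1E -f2E.
have c4 : P4 * (P2 - P1) = P1 * P2.
  apply/eqP; rewrite -tofrac_eq !tofracM tofracB; apply/eqP.
  apply: inv_diff_cross (nz _ s1) (nz _ s2) (nz _ s4) _.
  by rewrite -f1E -f2E.
have [Q1 [Q2 [sQ [P1E P2E]]]] := logpoly_pair h3 s1 s2 s3 s4 l1 l2 c3 c4.
exists Q1, Q2; split=> //; split.
  by apply: logpoly_wronskian_moore; rewrite // -P1E.
have M0 : moore Q1 Q2 != 0.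
  by case: sQ => _ _; apply: moore_neq0_coef.
rewrite wE f1E f2E /OmegaQ -/(moore Q1 Q2).
have one_div (p q : {poly k}) : p != 0 -> q * p = moore Q1 Q2 ->
    (p%:F)^-1 = q%:F / (moore Q1 Q2)%:F.
  move=> p0 e; rewrite -[LHS]mul1r -tofrac1; apply/frac_eqP => //.
  by rewrite mul1r e.
congr (F3span [tuple _; _]); apply: one_div.
- by rewrite -size_poly_gt0 s1.
- by rewrite P1E /moore; ring.
- by rewrite -size_poly_gt0 s2.
- by rewrite P2E /moore; ring.
Qed.

(** * The Frobenius action and the five explicit models *)

Lemma Phi_OmegaQ (Q1 Q2 : {poly k}) : moore Q1 Q2 != 0 ->
  (@Phi k @` OmegaQ Q1 Q2)%classic =
  OmegaQ (map_poly (fun c : k => c ^+ 3) Q1) (map_poly (fun c : k => c ^+ 3) Q2).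
Proof.
move=> M0; pose F := pFrobenius_aut hk.
rewrite -[map_poly _ Q1]/(map_poly F Q1) -[map_poly _ Q2]/(map_poly F Q2).
have ME : moore (map_poly F Q1) (map_poly F Q2) = map_poly F (moore Q1 Q2).
  by rewrite /moore rmorphB !rmorphM.
have key z1 z2 : z1 ^+ 3 = z1 -> z2 ^+ 3 = z2 ->
    Phi ((z1 *: Q2 - z2 *: Q1)%:F / (moore Q1 Q2)%:F) =
    (z1 *: map_poly F Q2 - z2 *: map_poly F Q1)%:F /
    (moore (map_poly F Q1) (map_poly F Q2))%:F.
  move=> e1 e2; rewrite (Phi_frac _ hk M0) ME; congr (_%:F / _).
  rewrite -[map_poly _ _]/(map_poly F (z1 *: Q2 - z2 *: Q1)) rmorphB /= !map_polyZ /=.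
  by rewrite !pFrobenius_autE e1 e2.
apply/seteqP; split=> f.
  move=> [g /OmegaQP[//|z1 [z2 [e1 e2 ->]]] <-]; apply/OmegaQP => //.
  by exists z1, z2; rewrite key.
move=> /OmegaQP[//|z1 [z2 [e1 e2 ->]]].
exists ((z1 *: Q2 - z2 *: Q1)%:F / (moore Q1 Q2)%:F); last exact: key.
by apply/OmegaQP => //; exists z1, z2.
Qed.

Lemma map_model_poly q y P a :
  map_poly (fun c : k => c ^+ 3) (model_poly q y P a) =
  model_poly (q ^+ 3) (y ^+ 3) (P ^+ 3) (a ^+ 3).
Proof.
pose F := pFrobenius_aut hk; rewrite -[LHS]/(map_poly F _) /model_poly.
rewrite rmorphD /= !map_polyZ !rmorphD /= !map_polyZ !map_polyXn map_polyX.
by rewrite !map_polyC /= !pFrobenius_autE -!mul_polyC /model_u; ring.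
Qed.

(** The equations of [model] have coefficients in F_3, so cubing them yields the same equations in
    the cubed parameters. *)
Lemma model_frob q y P a b : model q y P a b ->
  model (q ^+ 3) (y ^+ 3) (P ^+ 3) (a ^+ 3) (b ^+ 3).
Proof.
have root3 x : model_root q y P x -> model_root (q ^+ 3) (y ^+ 3) (P ^+ 3) (x ^+ 3).
  rewrite /model_root /= => /(congr1 (fun x => x ^+ 3)) e.
  apply: etrans (_ : (y ^+ 4 * x ^+ 9) ^+ 3 = _); first by ring.
  by rewrite e /model_u; ring.
move=> [QP q0 y0 yE [m0 ra rb]]; split; rewrite ?expf_neq0 //.
- by apply: etrans (_ : quintic P ^+ 3 = _); [rewrite /quintic; ring|rewrite QP expr0n].
- by rewrite yE /model_const /model_u; ring.
- split; [|exact: root3|exact: root3].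
  by have := expf_neq0 3 m0; congr (_ != 0); rewrite /moore; ring.
Qed.

Lemma Omega_frob q y P a b : model q y P a b ->
  (@Phi k @` OmegaQ (model_poly q y P a) (model_poly q y P b))%classic =
  OmegaQ (model_poly (q ^+ 3) (y ^+ 3) (P ^+ 3) (a ^+ 3))
         (model_poly (q ^+ 3) (y ^+ 3) (P ^+ 3) (b ^+ 3)).
Proof.
move=> [_ _ _ _ [m0 _ _]]; rewrite Phi_OmegaQ ?map_model_poly //.
by apply: (@moore_neq0_coef _ _ _ 5); rewrite !coef5_model_poly.
Qed.

(** Below, explicit algebraic elements are shown nonzero by exhibiting an inverse. *)
Lemma mul1_neq0 (x y : k) : x * y = 1 -> x != 0.
Proof.
by move=> e; apply/eqP => x0; move/eqP: e; rewrite x0 mul0r eq_sym oner_eq0.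
Qed.

(** The defining quintics have no term of degree 4, so no translation occurs. The last two
    parameters are the leading coefficients of [Q1] and [Q2]; the others come from splitting these
    as [a X + a^3 Y]. *)
Lemma model_Omega1 (mu : k) : mu ^+ 3 - mu + 1 = 0 ->
  model (- mu) (1 - mu) (mu + mu ^+ 2) (- mu) (mu ^+ 2 - mu - 1) /\
  Omega1 mu = OmegaQ (model_poly (- mu) (1 - mu) (mu + mu ^+ 2) (- mu))
                     (model_poly (- mu) (1 - mu) (mu + mu ^+ 2) (mu ^+ 2 - mu - 1)).
Proof.
move=> hmu; have {}hmu : mu ^+ 3 = mu - 1.
  by apply: subr0_eq; rewrite -hmu; ring.
have hP : mu%:P ^+ 3 = mu%:P - 1 by rewrite -rmorphXn /= hmu rmorphB.
split; last first.
  by rewrite /Omega1; congr OmegaQ; rewrite /model_poly /model_u -!mul_polyC; ring: hP.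
split.
- by rewrite /quintic; ring: hmu.
- by apply: (@mul1_neq0 _ (mu ^+ 2 - 1)); ring: hmu.
- by apply: (@mul1_neq0 _ (mu ^+ 2 + mu)); ring: hmu.
- by rewrite /model_const /model_u; ring: hmu.
- split; first last.
  + by rewrite /model_root /model_u /=; ring: hmu.
  + by rewrite /model_root /model_u /=; ring: hmu.
  apply: (@mul1_neq0 _ (1 + mu ^+ 2)).
  by rewrite /moore; ring: hmu.
Qed.

Lemma model_Omega2 (mu : k) : mu ^+ 4 + mu ^+ 3 - mu ^+ 2 - mu - 1 = 0 ->
  let a := - mu ^+ 20 in
  a ^+ 2 = -1 /\
  model (- (a + 1)) (a - 1) (a - 1) (- (a + 1)) a /\
  Omega2 mu = OmegaQ (model_poly (- (a + 1)) (a - 1) (a - 1) (- (a + 1)))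
                     (model_poly (- (a + 1)) (a - 1) (a - 1) a).
Proof.
move=> hmu; have {}hmu : mu ^+ 4 = - mu ^+ 3 + mu ^+ 2 + mu + 1.
  by apply: subr0_eq; rewrite -hmu; ring.
move=> a; have ha : a ^+ 2 = -1 by rewrite /a; ring: hmu.
(* From here on only [a ^+ 2 = -1] is kept. *)
rewrite /Omega2 -/a; clearbody a; split=> //.
have hP : a%:P ^+ 2 = -1 by rewrite -rmorphXn /= ha rmorphN.
split; last first.
  by congr OmegaQ; rewrite /model_poly /model_u -!mul_polyC; ring: hP.
split.
- by rewrite /quintic; ring: ha.
- by apply: (@mul1_neq0 _ (1 - a)); ring: ha.
- by apply: (@mul1_neq0 _ (a + 1)); ring: ha.
- by rewrite /model_const /model_u; ring: ha.
- split; first last.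
  + by rewrite /model_root /model_u /=; ring: ha.
  + by rewrite /model_root /model_u /=; ring: ha.
  apply: (@mul1_neq0 _ (- a)).
  by rewrite /moore; ring: ha.
Qed.

Lemma five_models (mu1 mu2 : k) :
  mu1 ^+ 3 - mu1 + 1 = 0 -> mu2 ^+ 4 + mu2 ^+ 3 - mu2 ^+ 2 - mu2 - 1 = 0 ->
  exists Ps : 5.-tuple k,
  [/\ uniq Ps, forall P, quintic P = 0 -> P \in Ps &
   forall i, exists q y a b, model q y (tnth Ps i) a b /\
     tnth (five_spaces mu1 mu2) i =
       OmegaQ (model_poly q y (tnth Ps i) a) (model_poly q y (tnth Ps i) b)].
Proof.
move=> hmu1 hmu2; have [m1 O1E] := model_Omega1 hmu1.
have [] := model_Omega2 hmu2; set al := - mu2 ^+ 20 => ha [m2 O2E].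
have hm : mu1 ^+ 3 = mu1 - 1 by apply: subr0_eq; rewrite -hmu1; ring.
set P1 := mu1 + mu1 ^+ 2 in m1 O1E; set P2 := al - 1 in m2 O2E.
(* [Phi] cubes the parameter, so these are the conjugates of [P1] in F_27 and of [P2] in F_9. *)
exists [tuple P1; P1 ^+ 3; P1 ^+ 3 ^+ 3; P2; P2 ^+ 3]; split.
- have ne (x y z : k) : (x - y) * z = 1 -> x != y.
    by move=> /mul1_neq0; rewrite subr_eq0.
  (* On a root of [T^2 - T - 1] the cubic [T^3 + T^2 - 1] takes the value 1, so the two families do
     not meet. *)
  have sep (x y : k) : x ^+ 3 + x ^+ 2 = 1 -> y ^+ 2 = y + 1 -> x != y.
    move=> ex ey; apply: contra_eqN ex => /eqP ->.
    by rewrite -subr_eq0; apply: (@mul1_neq0 _ 1); ring: ey.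
  have c1 : P1 ^+ 3 + P1 ^+ 2 = 1 by rewrite /P1; ring: hm.
  have s2 : P2 ^+ 2 = P2 + 1 by rewrite /P2; ring: ha.
  have c3 : (P1 ^+ 3) ^+ 3 + (P1 ^+ 3) ^+ 2 = 1 by rewrite /P1; ring: hm.
  have c9 : (P1 ^+ 3 ^+ 3) ^+ 3 + (P1 ^+ 3 ^+ 3) ^+ 2 = 1 by rewrite /P1; ring: hm.
  have s6 : (P2 ^+ 3) ^+ 2 = P2 ^+ 3 + 1 by rewrite /P2; ring: ha.
  have d1 : P1 != P1 ^+ 3.
    by apply: (ne _ _ (mu1 ^+ 2 - 1)); rewrite /P1; ring: hm.
  have d2 : P1 != P1 ^+ 3 ^+ 3.
    by apply: (ne _ _ (mu1 - mu1 ^+ 2)); rewrite /P1; ring: hm.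
  have d3 : P1 ^+ 3 != P1 ^+ 3 ^+ 3.
    by apply: (ne _ _ (mu1 + mu1 ^+ 2)); rewrite /P1; ring: hm.
  have d4 : P2 != P2 ^+ 3 by apply: (ne _ _ al); rewrite /P2; ring: ha.
  by rewrite /= !inE !negb_or d1 d2 d3 d4 !sep.
(* The disjunction becomes the vanishing of the product of the five linear factors, which equals
   [quintic P] modulo [hm] and [ha]. *)
- move=> P QP; rewrite !inE -![P == _]subr_eq0 -!mulf_eq0; apply/eqP.
  by rewrite -QP /quintic /P1 /P2; ring: hm ha.
- have m13 := model_frob m1; have m19 := model_frob m13; have m23 := model_frob m2.
  case=> [[|[|[|[|[|//]]]]] hi]; rewrite !(tnth_nth 0) (tnth_nth set0) /=.
  + by do 4 eexists; split; [exact: m1|exact: O1E].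
  + by do 4 eexists; split; [exact: m13|rewrite O1E Omega_frob].
  + by do 4 eexists; split; [exact: m19|rewrite O1E !Omega_frob].
  + by do 4 eexists; split; [exact: m2|exact: O2E].
  + by do 4 eexists; split; [exact: m23|rewrite O2E Omega_frob].
Qed.

End Final.

Theorem theorem6p6 (k : closedFieldType) (hk : 3%N \in [pchar k])
    (mu1 mu2 : k)
    (hmu1 : mu1 ^+ 3 - mu1 + 1 = 0)
    (hmu2 : mu2 ^+ 4 + mu2 ^+ 3 - mu2 ^+ 2 - mu2 - 1 = 0) :
  (forall Omega : set (ratfun k), Lspace 14 2 Omega ->
     exists i : 'I_5, space_equiv Omega (tnth (five_spaces mu1 mu2) i)) /\
  (forall i j : 'I_5, i != j ->
     ~ space_equiv (tnth (five_spaces mu1 mu2) i)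
                   (tnth (five_spaces mu1 mu2) j)).
Proof.
have h3 : 3 = 0 :> k by exact: pcharf0 hk.
have [Ps [/tuple_uniqP Puniq Proots models]] := five_models hk hmu1 hmu2.
split=> [Omega /(Lspace_pair hk)[Q1 [Q2 [[s1 s2 m0] [E ->]]]]|i j ij eqv].
  have [z [q [y [P [mP Q1E Q2E]]]]] := pair_model h3 s1 s2 m0 E.
  have /tnthP[i Pi] : P \in Ps by apply: Proots; case: mP.
  exists i; have [q' [y' [a' [b' [m' ->]]]]] := models i.
  rewrite -Pi in m' *; apply: model_equiv m' Q1E Q2E _ => //.
  exact: moore_neq0_coef m0.
have [q [y [a [b [m Ei]]]]] := models i.
have [q' [y' [a' [b' [m' Ej]]]]] := models j.
rewrite Ei Ej in eqv; have := model_equiv_param h3 m m' eqv.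
by move/Puniq/esym/eqP; rewrite (negPf ij).
Qed.
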